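(* Let $\Gamma$ be a graph with $v\ge d+2$ vertices, with vertex set $\mathcal V$, and let $p$ be a generic configuration in $C^d(\mathcal V)$. If the framework $(p,\Gamma)$ is universally rigid, then $(p,\Gamma)$ has a positive semidefinite equilibrium stress matrix of rank $v-d-1$.
   Context: A graph $\Gamma$ consists of a finite set $\mathcal V$ of $v$ vertices and a set $\mathcal E$ of edges, each a two-element subset of $\mathcal V$. A configuration is a map $p:\mathcal V\to\mathbb E^v$ (Euclidean space $\mathbb R^v$); $C(\mathcal V)$ is the space of all configurations. $C^d(\mathcal V)$ is the space of configurations whose image lies in $\mathbb E^d$, embedded in $\mathbb E^v$ as the first $d$ coordinates (the others being $0$). A framework $(p,\Gamma)$ is a graph together with a configuration of its vertices. A configuration in $C^d(\mathcal V)$ is generic if its $vd$ coordinates (the first $d$ coordinates of each vertex) do not satisfy any nontrivial polynomial equation with rational coefficients. Two configurations are congruent if they are related by a rigid motion of $\mathbb E^v$. A framework $(p,\Gamma)$ with $p\in C^d(\mathcal V)$ is universally rigid if every $q\in C(\mathcal V)$ with $|q(u)-q(w)|=|p(u)-p(w)|$ for all $\{u,w\}\in\mathcal E$ is congruent to $p$. An equilibrium stress matrix of $(p,\Gamma)$ is a real matrix $\Omega$ indexed by $\mathcal V\times\mathcal V$ such that (1) $\Omega(u,w)=\Omega(w,u)$ for all $u,w$; (2) $\Omega(u,w)=0$ whenever $u\ne w$ and $\{u,w\}\notin\mathcal E$; (3) $\sum_{w}\Omega(u,w)=0$ for all $u$; (4) $\sum_w\Omega(u,w)p(w)=0$ for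 all $u$. *)

(* Defs.v *)
From HB Require Import structures.
From mathcomp Require Import all_boot all_order all_algebra.
From mathcomp Require Import reals.
From mathcomp Require Import mpoly.

Set Implicit Arguments.
Unset Strict Implicit.
Unset Printing Implicit Defensive.

Import Order.TTheory GRing.Theory Num.Theory.

Local Open Scope ring_scope.

Record graph (V : finType) := Graph {
  edges : {set {set V}};
  card_edge : forall e, e \in edges -> #|e| = 2%N
}.

(* The ambient space of all configurations is E^v with v the number of
   vertices. *)
Definition config (R : realType) (V : finType) := V -> 'rV[R]_#|V|.

(* Euclidean length; the norm that MathComp-Analysis puts on matrices is the
   sup norm. *)
Definition enorm (R : realType) (n : nat) (x : 'rV[R]_n) : R :=
  Num.sqrt (\sum_i x 0 i ^+ 2).

Definition in_Cd (R : realType) (V : finType) (d : nat) (p : config R V) :=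
  forall (u : V) (i : 'I_#|V|), (d <= i)%N -> p u 0 i = 0.

(* Labels (u, i) of the first d coordinates of the vertices: there are v * d of
   them when d <= v. *)
Definition coord_index (V : finType) (d : nat) : {set V * 'I_#|V|} :=
  [set x : V * 'I_#|V| | (x.2 < d)%N].

Definition coord (R : realType) (V : finType) (d : nat) (p : config R V)
    (k : 'I_#|coord_index V d|) : R :=
  p (enum_val k).1 0 (enum_val k).2.

Definition generic (R : realType) (V : finType) (d : nat) (p : config R V) :=
  forall P : {mpoly rat[#|coord_index V d|]},
    P != 0 -> (map_mpoly (@ratr R) P).@[coord (d := d) p] != 0.

(* Distance-preserving self-maps of E^n, orientation-reversing ones included;
   bijectivity is automatic. *)
Definition rigid_motion (R : realType) (n : nat) (f : 'rV[R]_n -> 'rV[R]_n) :=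
  forall x y, enorm (f x - f y) = enorm (x - y).

Definition congruent (R : realType) (V : finType) (p q : config R V) :=
  exists2 f : 'rV[R]_#|V| -> 'rV[R]_#|V|,
    rigid_motion f & forall u, q u = f (p u).

Definition universally_rigid (R : realType) (V : finType) (p : config R V)
    (G : graph V) :=
  forall q : config R V,
    (forall u w : V, [set u; w] \in edges G ->
       enorm (q u - q w) = enorm (p u - p w)) ->
    congruent p q.

Record equilibrium_stress (R : realType) (V : finType) (p : config R V)
    (G : graph V) (Omega : V -> V -> R) : Prop := EquilibriumStress {
  stress_sym : forall u w, Omega u w = Omega w u;
  stress_supp : forall u w, u != w -> [set u; w] \notin edges G ->
                  Omega u w = 0;
  stress_row : forall u, \sum_w Omega u w = 0;
  stress_equil : forall u, \sum_w Omega u w *: p w = 0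
}.

Definition psd (R : realType) (V : finType) (Omega : V -> V -> R) :=
  forall x : V -> R, 0 <= \sum_u \sum_w x u * Omega u w * x w.

(* The rows and columns are enumerated by the canonical enumeration of V; the
   rank does not depend on it. *)
Definition rank (R : realType) (V : finType) (Omega : V -> V -> R) : nat :=
  \rank (\matrix_(i < #|V|, j < #|V|) Omega (enum_val i) (enum_val j)).

(* Main.v *)
(** The proof goes by a dichotomy. Separating the compact convex set of trace-one
    positive semidefinite matrices [B] supported on the orthogonal complement of
    the affine coordinate functions of [p] from the space of stresses, either
    some equilibrium stress is positive definite on that complement, hence has
    the required signature, or some [B] extends to a flex [(Z, B)]: on every
    edge [uw], [B u u + B w w - 2 B u w = <Z u - Z w, p u - p w>].

    The flex is a polynomial system over the rationals with coefficients [p], and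
    [p] is generic, so a solution persists along every sequence converging to [p]:
    adjoin the coordinates of the solution one by one to the ring of
    polynomials in the coordinates of [p].

    A persistent flex contradicts universal rigidity. For [x] near [p] and [Y]
    positive semidefinite near [0], minimise [k] times the squared error of the
    edge lengths of the Gram matrix [x x^T + Y], minus [<B, Y>], plus
    [|x - p|^2 + |Y|^2]. By universal rigidity the minimisers tend to [(p, 0)]
    as [k] grows. Moving a minimiser [(x, Y)] along [(- Z / 2, B)], for the flex
    at [x], changes the edge lengths to second order only, while the rest
    decreases with slope close to [- |B|^2]. *)
Require Import Defs.
From mathcomp Require Import all_boot all_order all_algebra.
From mathcomp Require Import reals.
From mathcomp Require Import boolp classical_sets topology normedtype.
From mathcomp Require Import sequences polyrcf zify ring lra.
From mathcomp Require Import -(notations) mpoly.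

Set Implicit Arguments.
Unset Strict Implicit.
Unset Printing Implicit Defensive.

Import Order.TTheory GRing.Theory Num.Theory.
Import numFieldNormedType.Exports.

Local Open Scope classical_set_scope.
Local Open Scope ring_scope.

(** * Sequences and compactness *)

Lemma cvg_sumr (R : realType) (T : Type) (F : set_system T) (FF : Filter F)
    (I : Type) (r : seq I) (P : pred I) (u : I -> T -> R) (l : I -> R) :
  (forall i, P i -> u i x @[x --> F] --> l i) ->
  \sum_(i <- r | P i) u i x @[x --> F] --> \sum_(i <- r | P i) l i.
Proof.
move=> ul; apply: cvg_big => // z.
by apply: cvgD; [exact: cvg_fst|exact: cvg_snd].
Qed.

Lemma cvg_prodr (R : realType) (T : Type) (F : set_system T) (FF : Filter F)
    (I : Type) (r : seq I) (P : pred I) (u : I -> T -> R) (l : I -> R) :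
  (forall i, P i -> u i x @[x --> F] --> l i) ->
  \prod_(i <- r | P i) u i x @[x --> F] --> \prod_(i <- r | P i) l i.
Proof.
move=> ul; apply: cvg_big => // z.
by apply: cvgM; [exact: cvg_fst|exact: cvg_snd].
Qed.

Lemma cvg_exprn (R : realType) (T : Type) (F : set_system T) (FF : Filter F)
    (u : T -> R) (l : R) (n : nat) :
  u x @[x --> F] --> l -> u x ^+ n @[x --> F] --> l ^+ n.
Proof.
move=> ul; elim: n => [|n IHn]; first exact: cvg_cst.
under eq_cvg do rewrite exprS.
by rewrite exprS; apply: cvgM.
Qed.

Lemma increasing_seq_geq (f : nat -> nat) (k : nat) :
  increasing_seq f -> (k <= f k)%N.
Proof.
move=> /increasing_seqP finc; elim: k => // k IHk.
by apply: leq_ltn_trans IHk _; have := finc k; rewrite ltEnat.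
Qed.

Lemma cvg_subseq (T : Type) (F : set_system T) (u : nat -> T) (f : nat -> nat) :
  increasing_seq f -> u k @[k --> \oo] --> F -> u (f k) @[k --> \oo] --> F.
Proof.
move=> finc uF A /uF [N _ NA]; exists N => // k /= Nk; apply: NA => /=.
exact: leq_trans Nk (increasing_seq_geq k finc).
Qed.

(** Coordinates are treated one after another; each passes to a further subsequence, which keeps the
    limits already found. *)
Lemma bolzano_weierstrass_fin (R : realType) (I : finType)
    (u : nat -> I -> R) (M : R) :
  (forall k i, `|u k i| <= M) ->
  exists2 f : nat -> nat, increasing_seq f &
    exists l : I -> R, forall i, u (f k) i @[k --> \oo] --> l i.
Proof.
move=> uM.
suff [f finc fcvg] : exists2 f : nat -> nat, increasing_seq f &
    forall i, i \in enum I -> exists l : R, u (f k) i @[k --> \oo] --> l.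
  exists f => //.
  have /choice[l fl] : forall i, exists l : R, u (f k) i @[k --> \oo] --> l.
    by move=> i; apply: fcvg; rewrite mem_enum.
  by exists l.
elim: (enum I) => [|i s [f finc fcvg]]; first by exists id.
have [|g ginc gcvg] := @bolzano_weierstrass R (fun k => u (f k) i).
  exists M; split; first exact: num_real.
  by move=> B MB k _; exact: le_trans (uM _ _) (ltW MB).
exists (f \o g) => [a b|j]; first by rewrite /= finc -leEnat ginc.
rewrite inE => /predU1P[-> | js].
  by exists (lim (u (f (g k)) i @[k --> \oo])); exact: gcvg.
have [l ul] := fcvg _ js.
by exists l; apply: (@cvg_subseq _ _ (fun k => u (f k) j)) ginc ul.
Qed.

(** Closedness and continuity are phrased through coordinatewise convergent sequences, so that
    Bolzano-Weierstrass alone yields this extreme value theorem. *)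
Lemma bounded_closed_minimum (R : realType) (I : finType)
    (K : (I -> R) -> Prop) (f : (I -> R) -> R) (M : R) :
  (exists z, K z) ->
  (forall z, K z -> forall i, `|z i| <= M) ->
  (forall (u : nat -> I -> R) l, (forall k, K (u k)) ->
     (forall i, u k i @[k --> \oo] --> l i) -> K l) ->
  (forall (u : nat -> I -> R) l,
     (forall i, u k i @[k --> \oo] --> l i) -> f (u k) @[k --> \oo] --> f l) ->
  exists2 z, K z & forall w, K w -> f z <= f w.
Proof.
move=> [z0 Kz0] KM Kclosed fcont.
(* Otherwise points with [f < -k] would have a convergent subsequence, along which [f] must
   converge. *)
have low : exists m, forall w, K w -> m <= f w.
  apply/not_existsP => nolow.
  have /choice[u uP] : forall k : nat, exists w, K w /\ f w < - k%:R.
    move=> k; have /existsNP[w /not_implyP[Kw /negP]] := nolow (- k%:R).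
    by rewrite -ltNge => fw; exists w.
  have [|g ginc [l ul]] := @bolzano_weierstrass_fin R I u M.
    by move=> k i; apply: KM; have [] := uP k.
  have /cvgrPdist_lt/(_ 1 ltr01)[N _ fN] := fcont _ _ ul.
  have [k kP] : exists k : nat, `|f l| + 1 < k%:R.
    by exists (Num.bound (`|f l| + 1)); apply: archi_boundP; rewrite addr_ge0.
  have := fN (maxn N k) (leq_maxl _ _).
  have [_] := uP (g (maxn N k)).
  have : (k%:R : R) <= (g (maxn N k))%:R.
    by rewrite ler_nat; apply: leq_trans (leq_maxr N k) (increasing_seq_geq _ ginc).
  have := ler_norm (f l); have := ler_norm (- f l); rewrite normrN ltr_norml.
  by move=> ? ? ? ? /andP[]; lra.
have inf_f : has_inf [set f w | w in K].
  split; first by exists (f z0), z0.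
  by have [m mP] := low; exists m => _ [w Kw <-]; exact: mP.
pose m := inf [set f w | w in K].
have /choice[u uP] : forall k : nat, exists w, K w /\ f w < m + harmonic k.
  by move=> k; have [_ [w Kw <-]] := inf_adherent (harmonic_gt0 k) inf_f; exists w.
have [|g ginc [l ul]] := @bolzano_weierstrass_fin R I u M.
  by move=> k i; apply: KM; have [] := uP k.
have Kl : K l by apply: Kclosed ul => k; have [] := uP (g k).
exists l => // w Kw; apply: (@le_trans _ _ m); last first.
  by apply: ge_inf; [exact: inf_f.2|exists w].
have lim_m : m + harmonic k @[k --> \oo] --> m.
  by rewrite -[X in _ --> X]addr0; apply: cvgD; [exact: cvg_cst|exact: cvg_harmonic].
have := @cvg_subseq _ _ (fun k => m + harmonic k) _ ginc lim_m.
move/(ler_cvg_to (fcont _ _ ul)); apply.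
by apply: nearW => k; have [_ /ltW] := uP (g k).
Qed.

(** One sequence must serve all [e] at once: [g k] is a point of [Q k] whose distance to [b] is
    within [harmonic k] of the infimum. *)
Lemma choose_approximants (R : realType) (Q : nat -> R -> Prop) (b : R) :
  (forall e, 0 < e -> \forall k \near \oo, exists2 t, Q k t & `|t - b| < e) ->
  exists2 g : nat -> R, g k @[k --> \oo] --> b & \forall k \near \oo, Q k (g k).
Proof.
move=> Qb.
have /choice[g gP] : forall k : nat, exists t, (exists t', Q k t') ->
    Q k t /\ forall t', Q k t' -> `|t - b| < `|t' - b| + harmonic k.
  (* The value 0 is a placeholder for the finitely many [k] with [Q k] empty. *)
  move=> k; have [[t0 Qt0]|noQ] := pselect (exists t, Q k t); last by exists 0.
  have infQ : has_inf [set `|t - b| | t in Q k].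
    by split; [exists `|t0 - b|, t0|exists 0 => _ [t _ <-]].
  have [_ [t Qt <-] tlt] := inf_adherent (harmonic_gt0 k) infQ.
  exists t => _; split=> // t' Qt'; apply: lt_le_trans tlt _.
  by rewrite lerD2r; apply: ge_inf; [exact: infQ.2|exists t'].
exists g.
  apply/cvgrPdist_lt => e e0; have e2 : 0 < e / 2 by rewrite divr_gt0.
  have /cvgrPdist_lt/(_ _ e2) harm := @cvg_harmonic R.
  near=> k.
  have [t Qt tb] : exists2 t, Q k t & `|t - b| < e / 2 by near: k; exact: Qb.
  have [|_ /(_ _ Qt) gt] := gP k; first by exists t.
  have : `|0 - harmonic k| < e / 2 :> R by near: k.
  rewrite sub0r normrN ger0_norm ?harmonic_ge0 // distrC => hk.
  by apply: lt_trans gt _; lra.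
near=> k.
have [t Qt _] : exists2 t, Q k t & `|t - b| < 1 by near: k; exact: Qb.
by have [|] := gP k; first by exists t.
Unshelve. all: end_near. Qed.

(** * Relations that persist along a sequence *)

(* [ev] evaluates the elements of [D] at the limit point of a sequence and
   [E k] at its [k]-th point. *)
Definition germ_section (R : realType) (D : nzRingType) (ev : D -> R)
    (E : nat -> D -> R) : Prop :=
  (forall c, E k c @[k --> \oo] --> ev c) /\
  (forall c, ev c = 0 -> \forall k \near \oo, E k c = 0).

Lemma cvg_horner_map (R : realType) (D : nzRingType) (ev : D -> R)
    (E : nat -> D -> R) (P : {poly D}) (g : nat -> R) (b : R) :
  (forall c, E k c @[k --> \oo] --> ev c) -> g k @[k --> \oo] --> b ->
  (map_poly (E k) P).[g k] @[k --> \oo] --> (map_poly ev P).[b].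
Proof.
move=> Eev gb; under eq_cvg do rewrite horner_poly.
rewrite horner_poly; apply: cvg_sumr => i _.
by apply: cvgM; [exact: Eev|exact: cvg_exprn].
Qed.

Lemma near_map_poly0 (R : realType) (D : nzRingType) (ev : {rmorphism D -> R})
    (E : nat -> {rmorphism D -> R}) (P : {poly D}) :
  germ_section ev E -> map_poly ev P = 0 ->
  \forall k \near \oo, map_poly (E k) P = 0.
Proof.
move=> [_ E0] evP.
have : \forall k \near \oo, forall i : 'I_(size P), E k P`_i = 0.
  by apply: filter_forall => i; apply: E0; rewrite -coef_map evP coef0.
apply: filterS => k EP; apply/polyP => i; rewrite coef_map coef0.
have [iP|iP] := ltnP i (size P); first exact: (EP (Ordinal iP)).
by rewrite nth_default // raddf0.
Qed.

(** The leading coefficient of [P] may vanish under [ev]; cutting [P] at the size of its image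
    leaves the image unchanged. *)
Lemma map_poly_truncate (R : fieldType) (D : idomainType)
    (ev : {rmorphism D -> R}) (P : {poly D}) :
  exists2 P' : {poly D}, map_poly ev P' = map_poly ev P &
    size P' = size (map_poly ev P).
Proof.
set n := size (map_poly ev P).
pose Q := \poly_(i < n) P`_i.
have evQ : map_poly ev Q = map_poly ev P.
  apply/polyP => i; rewrite !coef_map /= coef_poly.
  by case: ltnP => // ni; rewrite -coef_map nth_default // raddf0.
exists Q => //; apply/eqP; rewrite eqn_leq size_poly.
by rewrite /n -evQ; apply: size_poly.
Qed.

(** A minimal polynomial of [b] over the image of [ev], up to a scalar, lifted to [D]. The equality
    of sizes says that the leading coefficient of [m] survives [ev]. *)
Definition algebraic_relation (R : fieldType) (D : nzRingType) (ev : D -> R)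
    (b : R) (m : {poly D}) : Prop :=
  [/\ map_poly ev m != 0, size (map_poly ev m) = size m,
      (map_poly ev m).[b] = 0 &
      forall P, (map_poly ev P).[b] = 0 -> (size (map_poly ev P) < size m)%N ->
        map_poly ev P = 0].

Lemma exists_algebraic_relation (R : fieldType) (D : idomainType)
    (ev : {rmorphism D -> R}) (b : R) (P : {poly D}) :
  map_poly ev P != 0 -> (map_poly ev P).[b] = 0 ->
  exists m, algebraic_relation ev b m.
Proof.
elim: {P}_.+1 {-2}P (ltnSn (size (map_poly ev P))) => // n IHn P.
rewrite ltnS => leP evP Pb.
have [m evm sm] := map_poly_truncate ev P.
have [[P' [P'b ltP' P'0]]|noP'] := pselect (exists P', [/\ (map_poly ev P').[b] = 0,
    (size (map_poly ev P') < size m)%N & map_poly ev P' != 0]).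
  by apply: (IHn P') => //; apply: leq_trans ltP' _; rewrite sm.
exists m; split; rewrite ?evm // => P' P'b ltP'.
by have [//|P'0] := eqVneq (map_poly ev P') 0; case: noP'; exists P'.
Qed.

(** In characteristic zero the derivative is a nonzero polynomial of smaller degree, again the image
    of one over [D]; by minimality it cannot vanish at [b]. *)
Lemma algebraic_relation_simple (R : numFieldType) (D : idomainType)
    (ev : {rmorphism D -> R}) (b : R) (m : {poly D}) :
  algebraic_relation ev b m -> (map_poly ev m)^`().[b] != 0.
Proof.
move=> [f0 sf fb minf]; set f := map_poly ev m in f0 sf fb *.
apply/eqP => f'b.
have sf1 : (1 < size f)%N.
  by apply: (root_size_gt1 (a := b) f0); apply/rootP.
have sf' : (size f^`() < size m)%N by rewrite -sf lt_size_deriv.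
have := minf m^`(); rewrite -deriv_map => /(_ f'b sf')/polyP/(_ (size f).-2).
case sfE: (size f) sf1 => [|[|s]] //= _.
have : f`_s.+1 != 0 by have := f0; rewrite -lead_coef_eq0 lead_coefE sfE.
by rewrite coef0 coef_deriv => /negPf f1 /eqP; rewrite mulrn_eq0 f1.
Qed.

(** Write [f = (X - b) h] with [h(b) != 0]. Then [f(b - t) f(b + t) = - t^2 h(b - t) h(b + t)], and
    the product of the two values of [h] stays positive for small [t]. *)
Lemma simple_root_sign_change (R : rcfType) (f : {poly R}) (b e : R) :
  0 < e -> f.[b] = 0 -> f^`().[b] != 0 ->
  exists2 t, 0 < t < e & f.[b - t] * f.[b + t] < 0.
Proof.
move=> e0 /rootP/factor_theorem[h ->] f'b.
have {f'b} hb : h.[b] != 0.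
  move: f'b; rewrite derivM hornerD !hornerM derivXsubC hornerXsubC subrr.
  by rewrite mulr0 add0r hornerC mulr1.
pose p := (h \Po (b%:P - 'X)) * (h \Po (b%:P + 'X)).
have pE t : p.[t] = h.[b - t] * h.[b + t] by rewrite hornerM !horner_comp !hornerE.
have p0 : 0 < p.[0] by rewrite pE subr0 addr0 -expr2 exprn_even_gt0.
have [d d0 pd] := poly_cont 0 p p0.
pose t := Num.min (e / 2) (d / 2).
have t0 : 0 < t by rewrite lt_min !divr_gt0.
have te : t < e by have : t <= e / 2 by [rewrite ge_min lexx]; lra.
have td : t < d by have : t <= d / 2 by [rewrite ge_min lexx orbT]; lra.
exists t; first by rewrite t0.
have := pd t; rewrite subr0 gtr0_norm // => /(_ td); rewrite ltr_norml => /andP[pt _].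
have {pt} pt : 0 < p.[t] by lra.
rewrite !hornerM !hornerXsubC.
have -> : h.[b - t] * (b - t - b) * (h.[b + t] * (b + t - b)) = - (t ^+ 2 * p.[t]).
  by rewrite pE; ring.
by rewrite oppr_lt0 mulr_gt0 // exprn_gt0.
Qed.

(* The new element is realised by constants if it is transcendental, and by
   following a simple root of its minimal relation if it is algebraic. *)
Lemma germ_section_adjoin (R : realType) (D : idomainType)
    (ev : {rmorphism D -> R}) (E : nat -> {rmorphism D -> R}) (b : R) :
  germ_section ev (fun k => E k) ->
  exists g : nat -> R,
    germ_section (horner_eval b \o map_poly ev)
      (fun k => horner_eval (g k) \o map_poly (E k)).
Proof.
move=> germE; have [Eev E0] := germE.
have [[P P0 Pb]|transc] :=
    pselect (exists2 P, map_poly ev P != 0 & (map_poly ev P).[b] = 0); last first.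
  exists (fun=> b); split=> P; first by apply: cvg_horner_map => //; exact: cvg_cst.
  move=> Pb; have [evP|evP] := eqVneq (map_poly ev P) 0; last by case: transc; exists P.
  by apply: filterS (near_map_poly0 germE evP) => k EP; rewrite /= EP /horner_eval horner0.
have [m relm] := exists_algebraic_relation P0 Pb.
have [f0 sf fb minf] := relm.
(* The strict sign change of the limit polynomial around [b] passes to the polynomials at late
   stages [k], and the intermediate value theorem gives a root there. *)
have [g gb groot] : exists2 g : nat -> R, g k @[k --> \oo] --> b &
    \forall k \near \oo, (map_poly (E k) m).[g k] = 0.
  apply: (@choose_approximants _ (fun k t => (map_poly (E k) m).[t] = 0)) => e e0.
  have [t /andP[t0 te] ft] :=
    simple_root_sign_change e0 fb (algebraic_relation_simple relm).
  have : (map_poly (E k) m).[b - t] * (map_poly (E k) m).[b + t] @[k --> \oo]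
      --> (map_poly ev m).[b - t] * (map_poly ev m).[b + t].
    by apply: cvgM; apply: cvg_horner_map => //; exact: cvg_cst.
  move/cvgr_lt/(_ _ ft); apply: filterS => k Ekt.
  have [|x] := poly_ivtoo _ Ekt; first by lra.
  rewrite in_itv /= => /andP[xl xr] /rootP rx; exists x => //.
  by rewrite ltr_norml; lra.
have evm0 : ev (lead_coef m) != 0.
  by rewrite lead_coefE -coef_map -sf -lead_coefE lead_coef_eq0.
exists g; split=> Q; first exact: cvg_horner_map.
rewrite /= /horner_eval => Qb.
(* Pseudo-division: [a Q = q m + r] with [a] a power of the leading coefficient of [m]. If [Q]
   vanishes at [b], minimality kills the image of [r]; hence eventually [E k a] times the value of
   [Q] at [g k] is 0, with [E k a] nonzero. *)
have Qm := Pdiv.Idomain.divp_eq Q m.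
set a := lead_coef m ^+ _ in Qm; set r := Pdiv.IdomainDefs.modp Q m in Qm.
have mapQ (phi : {rmorphism D -> R}) t : (map_poly phi m).[t] = 0 ->
    phi a * (map_poly phi Q).[t] = (map_poly phi r).[t].
  move=> mt; rewrite -hornerZ -map_polyZ Qm rmorphD rmorphM /= hornerD hornerM mt.
  by rewrite mulr0 add0r.
have evr : map_poly ev r = 0.
  apply: minf; first by rewrite -mapQ // Qb mulr0.
  apply: leq_ltn_trans (size_poly _ _) _.
  rewrite Pdiv.Idomain.ltn_modp; apply: contraNneq f0 => ->.
  by rewrite map_poly0.
have nz : \forall k \near \oo, E k (lead_coef m) != 0.
  exact: cvgr_neq0 (Eev _) evm0.
near=> k.
have gk : (map_poly (E k) m).[g k] = 0 by near: k.
have rk : map_poly (E k) r = 0 by near: k; exact: near_map_poly0.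
have /eqP := mapQ (E k) _ gk; rewrite rk horner0 mulf_eq0 rmorphXn expf_eq0.
have /negPf -> : E k (lead_coef m) != 0 by near: k.
by rewrite andbF => /eqP.
Unshelve. all: end_near. Qed.

(** [D'] is an iterated polynomial ring over [D], one variable for each element of [s], and [i] is
    the inclusion. *)
Lemma germ_section_extend (R : realType) (D : idomainType)
    (ev : {rmorphism D -> R}) (E : nat -> {rmorphism D -> R}) (s : seq R) :
  germ_section ev (fun k => E k) ->
  exists (D' : idomainType) (ev' : {rmorphism D' -> R})
    (E' : nat -> {rmorphism D' -> R}) (i : D -> D'),
    [/\ germ_section ev' (fun k => E' k), forall c, ev' (i c) = ev c,
        forall k c, E' k (i c) = E k c &
        forall b, b \in s -> exists c, ev' c = b].
Proof.
elim: s D ev E => [|b s IHs] D ev E germE; first by exists D, ev, E, id.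
have [g germg] := germ_section_adjoin b germE.
have [D' [ev' [E' [i [germE' evi Ei sE']]]]] :=
  IHs _ (horner_eval b \o map_poly ev)
    (fun k => horner_eval (g k) \o map_poly (E k)) germg.
exists D', ev', E', (fun c => i c%:P); split=> //.
- by move=> c; rewrite evi /= /horner_eval map_polyC hornerC.
- by move=> k c; rewrite Ei /= /horner_eval map_polyC hornerC.
move=> x; rewrite inE => /predU1P[->|]; last exact: sE'.
by exists (i 'X); rewrite evi /= /horner_eval map_polyX hornerX.
Qed.

(** * Positive semidefinite matrices *)

Definition psdmx (R : realType) (n : nat) (S : 'M[R]_n) : Prop :=
  S^T = S /\ forall x : 'rV_n, 0 <= (x *m S *m x^T) 0 0.

(** For a Gram matrix [S], the squared distance between the points [u] and [w], as a linear form in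
    [S]. *)
Definition sqdist (R : realType) (n : nat) (S : 'M[R]_n) (u w : 'I_n) : R :=
  S u u + S w w - S u w - S w u.

Lemma quadE (R : realType) (n : nat) (S : 'M[R]_n) (x : 'rV_n) :
  (x *m S *m x^T) 0 0 = \sum_i \sum_j x 0 i * S i j * x 0 j.
Proof.
rewrite mxE exchange_big /=; apply: eq_bigr => j _.
by rewrite !mxE mulr_suml.
Qed.

Lemma gram_psdmx (R : realType) (m n : nat) (N : 'M[R]_(m, n)) :
  psdmx (N *m N^T).
Proof.
split=> [|x]; first by rewrite trmx_mul trmxK.
rewrite mulmxA -mulmxA -trmx_mul mxE; apply: sumr_ge0 => i _.
by rewrite [_^T _ _]mxE -expr2 sqr_ge0.
Qed.

Lemma psdmxD (R : realType) (n : nat) (S T : 'M[R]_n) :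
  psdmx S -> psdmx T -> psdmx (S + T).
Proof.
move=> [symS S0] [symT T0]; split=> [|x]; first by rewrite raddfD /= symS symT.
by rewrite mulmxDr mulmxDl mxE addr_ge0.
Qed.

Lemma psdmxZ (R : realType) (n : nat) (a : R) (S : 'M[R]_n) :
  0 <= a -> psdmx S -> psdmx (a *: S).
Proof.
move=> a0 [symS S0]; split=> [|x]; first by rewrite linearZ /= symS.
by rewrite -scalemxAr -scalemxAl mxE mulr_ge0.
Qed.

Lemma delta_bilin (R : realType) (n : nat) (S : 'M[R]_n) (u w : 'I_n) :
  ((delta_mx 0 u : 'rV_n) *m S *m (delta_mx 0 w : 'rV_n)^T) 0 0 = S u w.
Proof. by rewrite trmx_delta -rowE -colE !mxE. Qed.

Lemma quad_lin (R : realType) (n : nat) (S : 'M[R]_n) (x y : 'rV_n) (t : R) :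
  ((x + t *: y) *m S *m (x + t *: y)^T) 0 0 =
  (x *m S *m x^T) 0 0 + t * ((x *m S *m y^T) 0 0 + (y *m S *m x^T) 0 0)
    + t ^+ 2 * (y *m S *m y^T) 0 0.
Proof.
rewrite linearD linearZ /= !(mulmxDl, mulmxDr) -!scalemxAl -!scalemxAr.
set a := x *m S *m x^T; set b := y *m S *m x^T.
set c := x *m S *m y^T; set d := y *m S *m y^T.
by rewrite !mxE; ring.
Qed.

(** Testing the form on the sum and the difference of two basis vectors bounds [2 |S i j|] by
    [S i i + S j j]. This makes the trace-one matrices a bounded set. *)
Lemma psdmx_entry_le (R : realType) (n : nat) (S : 'M[R]_n) (i j : 'I_n) :
  psdmx S -> `|S i j| <= \tr S.
Proof.
move=> [symS S0].
have diag k : 0 <= S k k by rewrite -delta_bilin.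
have leTr : i != j -> S i i + S j j <= \tr S.
  move=> ij; rewrite /mxtrace (bigD1 i) //= (bigD1 j) 1?eq_sym //= addrA lerDl.
  by apply: sumr_ge0.
have [<-|/leTr tr] := eqVneq i j.
  by rewrite ger0_norm // /mxtrace (bigD1 i) //= lerDl; apply: sumr_ge0.
have sij : S j i = S i j by rewrite -[in LHS]symS mxE.
have := S0 (delta_mx 0 i + (-1) *: delta_mx 0 j).
have := S0 (delta_mx 0 i + 1 *: delta_mx 0 j).
rewrite !quad_lin !delta_bilin sij => p1 p2.
by rewrite ler_norml; have := diag i; have := diag j; lra.
Qed.

(* One step of the Cholesky algorithm; if the pivot [a] vanishes then so does
   [b], and [a^-1 = 0] makes the same formula valid. *)
Lemma psdmx_gram (R : realType) (n : nat) (S : 'M[R]_n) :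
  psdmx S -> exists N : 'M[R]_n, S = N *m N^T.
Proof.
elim: n S => [|n IHn] S; first by exists 0; apply/matrixP => -[].
rewrite -[n.+1]/(1 + n)%N in S *.
rewrite -[S]submxK; set b := dlsubmx S; set C := drsubmx S.
rewrite [ulsubmx S]mx11_scalar; set a := ulsubmx S 0 0.
move=> [symS S0]; move: symS; rewrite tr_block_mx => /eq_block_mx[_ + _ symC].
move=> ub; rewrite -ub in S0 *.
have S0' (t : R) (y : 'rV[R]_n) :
    0 <= t ^+ 2 * a + 2 * t * (y *m b) 0 0 + (y *m C *m y^T) 0 0.
  have := S0 (row_mx t%:M y).
  rewrite mul_row_block tr_row_mx mul_row_col !mulmxDl tr_scalar_mx.
  rewrite -!scalar_mxM !mul_mx_scalar !mul_scalar_mx -scalemxAl -trmx_mul.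
  rewrite !mxE eqxx mulr1n => h; apply: le_trans h _.
  by rewrite le_eqVlt; apply/orP; left; apply/eqP; rewrite ?mxE; ring.
have a0 : 0 <= a by have := S0' 1 0; rewrite !mul0mx !mxE; lra.
have b0 : a = 0 -> b = 0.
  move=> az; apply/matrixP => i j; rewrite ord1 [RHS]mxE; apply/eqP/negPn/negP => bi.
  pose y : 'rV[R]_n := delta_mx 0 i.
  have yb : (y *m b) 0 0 = b i 0 by rewrite -rowE mxE.
  (* With [a = 0] the form is affine in its first variable; this value of [t] makes it [-1]. *)
  have := S0' (- (((y *m C *m y^T) 0 0 + 1) / (2 * b i 0))) y; rewrite az yb.
  set c := (_ *m _) 0 0.
  have -> : 2 * - ((c + 1) / (2 * b i 0)) * b i 0 = - (c + 1) by field; rewrite bi.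
  lra.
have bb : (a^-1 *: (b *m b^T))^T = a^-1 *: (b *m b^T).
  by rewrite linearZ /= trmx_mul trmxK.
have [|N' NC] := IHn (C - a^-1 *: (b *m b^T)).
  split=> [|y]; first by rewrite raddfB /= symC bb.
  have -> : (y *m (C - a^-1 *: (b *m b^T)) *m y^T) 0 0 =
      (y *m C *m y^T) 0 0 - a^-1 * (y *m b) 0 0 ^+ 2.
    have <- : (y *m (b *m b^T) *m y^T) 0 0 = (y *m b) 0 0 ^+ 2.
      by rewrite mulmxA -mulmxA -trmx_mul mxE big_ord1 [_^T _ _]mxE expr2.
    rewrite mulmxBr mulmxBl -scalemxAr -scalemxAl.
    by set A1 := y *m C *m y^T; set A2 := y *m _ *m y^T; rewrite !mxE.
  (* This [t] minimises the form for fixed [y] and leaves the form of the Schur complement. *)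
  have := S0' (- a^-1 * (y *m b) 0 0) y.
  have [az|an0] := eqVneq a 0; first by rewrite az invr0; lra.
  move=> h; apply: le_trans h _; rewrite le_eqVlt; apply/orP; left; apply/eqP.
  by field; exact: an0.
pose r := Num.sqrt a.
have rr : r * r = a by rewrite -expr2 sqr_sqrtr.
have rb : (r * r^-1) *: b = b.
  have [r0|r0] := eqVneq r 0; last by rewrite divff ?scale1r.
  by rewrite b0 ?scaler0 // -rr r0 mul0r.
exists (block_mx r%:M 0 (r^-1 *: b) N').
rewrite tr_block_mx mulmx_block !trmx0 tr_scalar_mx linearZ /=.
rewrite !mul0mx !mulmx0 !addr0 -scalar_mxM rr mul_mx_scalar mul_scalar_mx !scalerA.
rewrite rb [r * _]mulrC -NC -scalemxAl -scalemxAr scalerA -invfM rr addrC subrK.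
by rewrite -linearZ /= [_ * r]mulrC rb.
Qed.

(** * Stresses and flexes *)

Lemma sum_enum_val (R : nmodType) (I : finType) (F : I -> R) :
  \sum_i F i = \sum_(k < #|I|) F (enum_val k).
Proof. by rewrite -(big_enum_val F). Qed.

(** The columns of the cokernel matrix are equations of the row space of [M]; [separation] measures
    the distance to that space with them. *)
Lemma exists_cokernel (F : fieldType) (I J : finType) (M : I -> J -> F) :
  exists C : J -> J -> F,
    (forall i l, \sum_j M i j * C j l = 0) /\
    forall b : J -> F, (forall l, \sum_j b j * C j l = 0) ->
      exists y : I -> F, forall j, b j = \sum_i y i * M i j.
Proof.
pose M' := \matrix_(i < #|I|, j < #|J|) M (enum_val i) (enum_val j).
have M'E i k : M' (enum_rank i) k = M i (enum_val k) by rewrite mxE enum_rankK.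
exists (fun j l => cokermx M' (enum_rank j) (enum_rank l)); split=> [i l|b b0].
  have /matrixP/(_ (enum_rank i) (enum_rank l)) := mulmx_coker M'.
  rewrite [LHS]mxE [RHS]mxE => h; rewrite -[RHS]h [LHS]sum_enum_val.
  by apply: eq_bigr => k _; rewrite M'E enum_valK.
pose b' : 'rV_#|J| := \row_j b (enum_val j).
have /submxP[y yb] : (b' <= M')%MS.
  rewrite submxE; apply/eqP/rowP => l; rewrite [LHS]mxE [RHS]mxE.
  rewrite -[RHS](b0 (enum_val l)) [RHS]sum_enum_val.
  by apply: eq_bigr => k _; rewrite [b' _ _]mxE !enum_valK.
exists (fun i => y 0 (enum_rank i)) => j.
have /rowP/(_ (enum_rank j)) := yb; rewrite [LHS]mxE [RHS]mxE enum_rankK => ->.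
rewrite [RHS]sum_enum_val; apply: eq_bigr => k _.
by rewrite enum_valK mxE enum_rankK.
Qed.

(** The first-order condition at a minimum: were [a] negative, the step [t = - a / (- a + |c| + 1)]
    would make [a + t c] negative. *)
Lemma ler0_linear_quadratic (R : realFieldType) (a c : R) :
  (forall t, 0 < t <= 1 -> 0 <= t * a + t ^+ 2 * c) -> 0 <= a.
Proof.
move=> h; rewrite leNgt; apply/negP => a0.
pose t := - a / (- a + `|c| + 1).
have c0 : 0 <= `|c| by [].
have d0 : 0 < - a + `|c| + 1 by lra.
have t0 : 0 < t by rewrite divr_gt0 // oppr_gt0.
have t1 : t <= 1 by rewrite ler_pdivrMr // mul1r; lra.
have tE : t * (- a + `|c| + 1) = - a by rewrite divfK // gt_eqF.
have := h t; rewrite t0 t1 => /(_ isT).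
have -> : t * a + t ^+ 2 * c = t * (a + t * c) by ring.
rewrite pmulr_rge0 //.
have : t * c <= t * `|c| by rewrite ler_pM2l // ler_norm.
have : 0 < t * (- a) by rewrite mulr_gt0 // oppr_gt0.
by move: tE; rewrite !mulrDr mulr1; lra.
Qed.

(* Minimise the squared distance from the image of [K] under [L] to the row
   space of [M]: a positive minimum yields the separating functional. *)
Lemma separation (R : realType) (T I J : finType) (K : (T -> R) -> Prop)
    (b : (T -> R) -> J -> R) (M : I -> J -> R) (B : R) :
  (forall z, K z -> forall t, `|z t| <= B) ->
  (forall (u : nat -> T -> R) l, (forall k, K (u k)) ->
     (forall t, u k t @[k --> \oo] --> l t) -> K l) ->
  (forall z w, K z -> K w -> forall t, 0 <= t <= 1 ->
     K (fun i => (1 - t) * z i + t * w i)) ->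
  (forall z w s t j, b (fun i => s * z i + t * w i) j = s * b z j + t * b w j) ->
  (forall (u : nat -> T -> R) l, (forall t, u k t @[k --> \oo] --> l t) ->
     forall j, b (u k) j @[k --> \oo] --> b l j) ->
  (exists2 c : J -> R, forall i, \sum_j M i j * c j = 0 &
     forall z, K z -> 0 < \sum_j b z j * c j) \/
  (exists2 z, K z & exists y : I -> R, forall j, b z j = \sum_i y i * M i j).
Proof.
move=> KB Kclosed Kconv blin bcont.
have [C [MC cokC]] := exists_cokernel M.
(* [phi z] vanishes exactly when [b z] lies in the row space of [M]. *)
pose phi z l := \sum_j b z j * C j l.
have [[z0 Kz0]|noK] := pselect (exists z, K z); last first.
  left; exists (fun=> 0) => [i|z Kz]; last by case: noK; exists z.
  by rewrite big1 // => j _; rewrite mulr0.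
have [||z Kz zmin] := @bounded_closed_minimum R T K
    (fun z => \sum_l phi z l ^+ 2) B _ KB Kclosed.
- by exists z0.
- move=> u l ul; apply: cvg_sumr => i _; apply: cvg_exprn; apply: cvg_sumr => j _.
  by apply: cvgM; [exact: bcont|exact: cvg_cst].
have [phi0|phin0] := eqVneq (\sum_l phi z l ^+ 2) 0.
  right; exists z => //; apply: cokC => l; apply/eqP; rewrite -sqrf_eq0.
  have /eqP := phi0; rewrite psumr_eq0 => [/allP/(_ l)|i _]; last exact: sqr_ge0.
  by rewrite mem_index_enum => /(_ isT).
(* Up to a factor 2, the gradient of the sum of the [phi z l ^+ 2] as a function of [b z]. *)
left; exists (fun j => \sum_l C j l * phi z l) => [i|w Kw].
  under eq_bigr do rewrite mulr_sumr.
  rewrite exchange_big big1 //= => l _.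
  under eq_bigr do rewrite mulrA.
  by rewrite -mulr_suml MC mul0r.
have -> : \sum_j b w j * (\sum_l C j l * phi z l) = \sum_l phi w l * phi z l.
  under eq_bigr do rewrite mulr_sumr.
  rewrite exchange_big; apply: eq_bigr => l _ /=.
  by rewrite mulr_suml; apply: eq_bigr => j _; rewrite mulrA.
have pos : 0 < \sum_l phi z l ^+ 2.
  by rewrite lt_def phin0 sumr_ge0 // => l _; exact: sqr_ge0.
(* Minimality on the segment from [z] to [w] gives [<phi z, phi w - phi z> >= 0], so
   [<phi z, phi w>] is at least [|phi z|^2]. *)
apply: lt_le_trans pos _; rewrite -subr_ge0 -sumrB.
rewrite -(pmulr_rge0 _ (ltr0n R 2)).
apply: (@ler0_linear_quadratic _ _ (\sum_l (phi w l - phi z l) ^+ 2)) => t /andP[t0 t1].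
have := zmin (fun i => (1 - t) * z i + t * w i).
rewrite -subr_ge0 -sumrB => /(_ _)/le_trans; apply.
  by apply: Kconv => //; rewrite ltW.
rewrite le_eqVlt; apply/orP; left; apply/eqP.
rewrite !mulr_sumr -big_split; apply: eq_bigr => l _ /=.
have -> : phi (fun i => (1 - t) * z i + t * w i) l = (1 - t) * phi z l + t * phi w l.
  rewrite /phi !mulr_sumr -big_split; apply: eq_bigr => j _ /=.
  by rewrite blin; ring.
by ring.
Qed.

(** The graph Laplacian with weights [c], as a sum of rank-one terms over ordered pairs; symmetry
    and zero row sums are built in. *)
Definition edge_stress (R : realType) (n : nat) (e : rel 'I_n)
    (c : 'I_n * 'I_n -> R) : 'M[R]_n :=
  \matrix_(a, b) \sum_(t : 'I_n * 'I_n) (if e t.1 t.2 then c t else 0) *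
    (((a == t.1)%:R - (a == t.2)%:R) * ((b == t.1)%:R - (b == t.2)%:R)).

Lemma sum_delta (R : realType) (I : finType) (u : I) (F : I -> R) :
  \sum_i (i == u)%:R * F i = F u.
Proof.
rewrite (bigD1 u) //= eqxx mul1r big1 ?addr0 // => i /negPf ->.
by rewrite mul0r.
Qed.

Lemma sum_delta_sub (R : realType) (I : finType) (u w : I) (F : I -> R) :
  \sum_i ((i == u)%:R - (i == w)%:R) * F i = F u - F w.
Proof.
by under eq_bigr do rewrite mulrBl; rewrite sumrB !sum_delta.
Qed.

Lemma edge_stress_sym (R : realType) (n : nat) (e : rel 'I_n)
    (c : 'I_n * 'I_n -> R) : (edge_stress e c)^T = edge_stress e c.
Proof.
apply/matrixP => a b; rewrite !mxE; apply: eq_bigr => t _.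
by congr (_ * _); rewrite mulrC.
Qed.

(** A summand is nonzero at [(a, b)] only if [a] and [b] are both endpoints of its pair. *)
Lemma edge_stress_supp (R : realType) (n : nat) (e : rel 'I_n)
    (c : 'I_n * 'I_n -> R) (a b : 'I_n) :
  a != b -> ~~ e a b -> ~~ e b a -> edge_stress e c a b = 0.
Proof.
move=> ab eab eba; rewrite mxE big1 // => -[u w] _ /=.
case: ifP => euw; last by rewrite mul0r.
have [au|au] := eqVneq a u; have [aw|aw] := eqVneq a w;
  have [bu|bu] := eqVneq b u; have [bw|bw] := eqVneq b w; subst => //;
  rewrite ?eqxx ?subrr ?mulr0 ?mul0r ?subr0 ?mulr0 //.
- by rewrite eqxx in ab.
- by rewrite euw in eab.
- by rewrite euw in eba.
- by rewrite eqxx in ab.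
Qed.

(** Equilibrium becomes a linear condition on the weights [c], whose coefficients form the matrix
    [M] of [stress_or_flex]. *)
Lemma edge_stress_mul (R : realType) (n m : nat) (e : rel 'I_n)
    (c : 'I_n * 'I_n -> R) (P : 'M_(n, m)) (a : 'I_n) (k : 'I_m) :
  (edge_stress e c *m P) a k =
  \sum_t (if e t.1 t.2 then ((a == t.1)%:R - (a == t.2)%:R) * (P t.1 k - P t.2 k)
          else 0) * c t.
Proof.
rewrite mxE; under eq_bigr do rewrite mxE mulr_suml.
rewrite exchange_big; apply: eq_bigr => t _ /=.
case: ifP => _; last by rewrite mul0r big1 // => i _; rewrite !mul0r.
rewrite -(sum_delta_sub t.1 t.2 (fun i => P i k)) mulr_sumr mulr_suml.
by apply: eq_bigr => i _; ring.
Qed.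

Lemma edge_stress_mul1 (R : realType) (n : nat) (e : rel 'I_n)
    (c : 'I_n * 'I_n -> R) : edge_stress e c *m const_mx 1 = 0 :> 'cV_n.
Proof.
apply/matrixP => a k; rewrite edge_stress_mul [RHS]mxE big1 // => t _.
by rewrite !mxE subrr mulr0 if_same mul0r.
Qed.

(** Here [y] is a configuration on the line, with Gram matrix [y^T *m y]: each weight multiplies a
    squared edge length. *)
Lemma edge_stress_quad (R : realType) (n : nat) (e : rel 'I_n)
    (c : 'I_n * 'I_n -> R) (y : 'rV_n) :
  (y *m edge_stress e c *m y^T) 0 0 =
  \sum_t (if e t.1 t.2 then sqdist (y^T *m y) t.1 t.2 else 0) * c t.
Proof.
rewrite -mulmxA mxE; under eq_bigr do rewrite edge_stress_mul mulr_sumr.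
rewrite exchange_big; apply: eq_bigr => t _ /=.
case: ifP => _; last by rewrite mul0r big1 // => i _; rewrite mulr0.
under eq_bigr do rewrite [y^T t.1 0]mxE [y^T t.2 0]mxE.
transitivity ((\sum_i ((i == t.1)%:R - (i == t.2)%:R) * y 0 i) *
    (y 0 t.1 - y 0 t.2) * c t).
  by rewrite !mulr_suml; apply: eq_bigr => i _; ring.
rewrite sum_delta_sub; congr (_ * _).
by rewrite /sqdist !mxE !big_ord1 !mxE; ring.
Qed.

Lemma eq_cvg_lim (R : realType) (u v : nat -> R) (a b : R) :
  u k @[k --> \oo] --> a -> v k @[k --> \oo] --> b ->
  (\forall k \near \oo, u k = v k) -> a = b.
Proof.
move=> ua vb uv; apply/eqP; rewrite eq_le; apply/andP; split.
  by apply: ler_cvg_to ua vb _; apply: filterS uv => k ->.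
by apply: ler_cvg_to vb ua _; apply: filterS uv => k ->.
Qed.

Lemma cvg_cst_lim (R : realType) (u : nat -> R) (a b : R) :
  u k @[k --> \oo] --> a -> (\forall k \near \oo, u k = b) -> a = b.
Proof. by move=> ua ub; apply: eq_cvg_lim ua (cvg_cst b) ub. Qed.

Lemma cvg_le_lim (R : realType) (u : nat -> R) (a b : R) :
  u k @[k --> \oo] --> a -> (\forall k \near \oo, u k <= b) -> a <= b.
Proof. by move=> ua ub; apply: ler_cvg_to ua (cvg_cst b) ub. Qed.

Lemma cvg_mulmxl (R : realType) (m n p : nat) (u : nat -> 'M[R]_(m, n))
    (l : 'M[R]_(m, n)) (N : 'M[R]_(n, p)) (i : 'I_m) (j : 'I_p) :
  (forall a b, u k a b @[k --> \oo] --> l a b) ->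
  (u k *m N) i j @[k --> \oo] --> (l *m N) i j.
Proof.
move=> ul; rewrite mxE; under eq_cvg do rewrite mxE.
by apply: cvg_sumr => a _; apply: cvgM; [exact: ul|exact: cvg_cst].
Qed.

Lemma cvg_sqdist (R : realType) (n : nat) (S : nat -> 'M[R]_n) (l : 'M[R]_n)
    (u w : 'I_n) :
  (forall a b, S k a b @[k --> \oo] --> l a b) ->
  sqdist (S k) u w @[k --> \oo] --> sqdist l u w.
Proof. by move=> Sl; do 2![apply: cvgB => //]; apply: cvgD. Qed.

Lemma psdmx_closed (R : realType) (n : nat) (u : nat -> 'M[R]_n) (l : 'M[R]_n) :
  (forall k, psdmx (u k)) ->
  (forall a b, u k a b @[k --> \oo] --> l a b) -> psdmx l.
Proof.
move=> psdu ul; split=> [|x].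
  apply/matrixP => a b; rewrite mxE; apply: eq_cvg_lim (ul b a) (ul a b) _.
  by apply: nearW => k; rewrite -[in RHS](psdu k).1 mxE.
have ux : (x *m u k *m x^T) 0 0 @[k --> \oo] --> (x *m l *m x^T) 0 0.
  rewrite quadE; under eq_cvg do rewrite quadE.
  apply: cvg_sumr => a _; apply: cvg_sumr => b _.
  by apply: cvgM; [apply: cvgM; [exact: cvg_cst|exact: ul]|exact: cvg_cst].
by apply: ler_cvg_to (cvg_cst 0) ux _; apply: nearW => k; exact: (psdu k).2.
Qed.

(** [separation] is applied to the trace-one matrices of [K], with [b] their squared edge lengths
    and [M] the rigidity matrix of [P]. A functional orthogonal to the rows of [M] is an equilibrium
    stress; the coefficients of a row combination form the flex [Z]. *)
Lemma stress_or_flex (R : realType) (n d : nat) (e : rel 'I_n)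
    (P : 'M[R]_(n, d)) :
  (exists2 c, edge_stress e c *m P = 0 &
     forall y : 'rV_n, y != 0 -> y *m P = 0 -> y *m const_mx 1 = 0 :> 'rV_1 ->
       0 < (y *m edge_stress e c *m y^T) 0 0) \/
  (exists (B : 'M[R]_n) (Z : 'M[R]_(n, d)),
     [/\ psdmx B, B != 0, B *m P = 0, B *m const_mx 1 = 0 :> 'cV_n &
       forall u w, e u w ->
         sqdist B u w = \sum_k (Z u k - Z w k) * (P u k - P w k)]).
Proof.
pose mx (z : 'I_n * 'I_n -> R) : 'M[R]_n := \matrix_(i, j) z (i, j).
have mxlin z w s t : mx (fun i => s * z i + t * w i) = s *: mx z + t *: mx w.
  by apply/matrixP => i j; rewrite !mxE.
pose K z := [/\ psdmx (mx z), mx z *m P = 0, mx z *m const_mx 1 = 0 :> 'cV_n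
  & \tr (mx z) = 1].
pose b z t := if e t.1 t.2 then sqdist (mx z) t.1 t.2 else 0.
pose M (i : 'I_n * 'I_d) t := if e t.1 t.2
  then ((i.1 == t.1)%:R - (i.1 == t.2)%:R) * (P t.1 i.2 - P t.2 i.2) else 0.
have mxcvg (u : nat -> 'I_n * 'I_n -> R) l : (forall t, u k t @[k --> \oo] --> l t) ->
    forall i j, mx (u k) i j @[k --> \oo] --> mx l i j.
  by move=> ul i j; rewrite mxE; under eq_cvg do rewrite mxE; exact: ul.
have [|||||[c cM cK]|[z [psdz zP z1 trz] [y yM]]] := @separation R _ _ _ K b M 1.
- by move=> z [psdz _ _ trz] [i j]; have := psdmx_entry_le i j psdz; rewrite trz mxE.
- move=> u l Ku ul; have ul' := mxcvg _ _ ul; split.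
  + by apply: psdmx_closed ul' => k; have [] := Ku k.
  + apply/matrixP => i j; apply: cvg_cst_lim (cvg_mulmxl ul') _.
    by apply: nearW => k; have [_ -> _ _] := Ku k.
  + apply/matrixP => i j; apply: cvg_cst_lim (cvg_mulmxl ul') _.
    by apply: nearW => k; have [_ _ -> _] := Ku k.
  + have trl : \tr (mx (u k)) @[k --> \oo] --> \tr (mx l).
      by apply: cvg_sumr => i _; exact: ul'.
    apply: cvg_cst_lim trl _.
    by apply: nearW => k; have [_ _ _ ->] := Ku k.
- move=> z w [psdz zP z1 trz] [psdw wP w1 trw] t /andP[t0 t1]; rewrite /K mxlin.
  split.
  + by apply: psdmxD; apply: psdmxZ; rewrite ?subr_ge0.
  + by rewrite mulmxDl -!scalemxAl zP wP !scaler0 addr0.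
  + by rewrite mulmxDl -!scalemxAl z1 w1 !scaler0 addr0.
  + by rewrite raddfD /= !mxtraceZ trz trw; ring.
- move=> z w s t j; rewrite /b mxlin; case: ifP => _; last by ring.
  by rewrite /sqdist !mxE; ring.
- move=> u l ul j; rewrite /b; case: ifP => _; last exact: cvg_cst.
  exact/cvg_sqdist/mxcvg.
- left; exists c; first by apply/matrixP => a k; rewrite edge_stress_mul mxE (cM (a, k)).
  move=> y y0 yP y1.
  have yy : 0 < \tr (y^T *m y).
    rewrite mxtrace_mulC /mxtrace big_ord1 mxE.
    have /rV0Pn[i yi] := y0.
    rewrite (bigD1 i) //= ltr_pwDl //.
      by rewrite mxE -expr2 exprn_even_gt0.
    by apply: sumr_ge0 => j _; rewrite mxE -expr2 sqr_ge0.
  (* The rank-one matrix of [y], scaled to trace one, lies in [K]; positivity there is positivity of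
     the stress at [y]. *)
  pose z (t : 'I_n * 'I_n) := (\tr (y^T *m y))^-1 * (y^T *m y) t.1 t.2.
  have mxz : mx z = (\tr (y^T *m y))^-1 *: (y^T *m y).
    by apply/matrixP => i j; rewrite mxE [RHS]mxE.
  have /cK : K z.
    rewrite /K mxz; split.
    + by apply: psdmxZ; [rewrite invr_ge0 ltW|have := gram_psdmx y^T; rewrite trmxK].
    + by rewrite -scalemxAl -mulmxA yP mulmx0 scaler0.
    + by rewrite -scalemxAl -mulmxA y1 mulmx0 scaler0.
    + by rewrite mxtraceZ mulVf // gt_eqF.
  rewrite edge_stress_quad.
  have -> : \sum_j b z j * c j = (\tr (y^T *m y))^-1 *
      \sum_t (if e t.1 t.2 then sqdist (y^T *m y) t.1 t.2 else 0) * c t.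
    rewrite mulr_sumr; apply: eq_bigr => t _; rewrite /b.
    case: ifP => _; last by rewrite !mul0r mulr0.
    by rewrite /sqdist ![mx z _ _]mxE /z /=; ring.
  by rewrite pmulr_rgt0 // invr_gt0.
- right; exists (mx z), (\matrix_(u, k) y (u, k)); split => //.
    by apply/eqP => z0; move: trz; rewrite z0 mxtrace0 => /eqP; rewrite eq_sym oner_eq0.
  move=> u w euw; have := yM (u, w); rewrite /b /M /= euw => ->.
  transitivity (\sum_v \sum_k y (v, k) *
      (((v == u)%:R - (v == w)%:R) * (P u k - P w k))).
    by rewrite pair_bigA; apply: eq_bigr => -[v k] _.
  rewrite exchange_big; apply: eq_bigr => k _ /=.
  rewrite !mxE -(sum_delta_sub u w (fun v => y (v, k))).
  by rewrite mulr_suml; apply: eq_bigr => v _; ring.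
Qed.

(** * Generic points *)

(** Genericity in the form in which it acts: along any sequence tending to [P], an integral
    polynomial relation between the entries of [P] holds from some stage on. *)
Definition generic_point (R : realType) (n d : nat) (P : 'M[R]_(n, d)) : Prop :=
  forall x : nat -> 'M[R]_(n, d), (forall u i, x k u i @[k --> \oo] --> P u i) ->
  exists (D : idomainType) (ev : {rmorphism D -> R})
    (E : nat -> {rmorphism D -> R}) (c : 'I_n -> 'I_d -> D),
    [/\ germ_section ev (fun k => E k), forall u i, ev (c u i) = P u i &
        forall k u i, E k (c u i) = x k u i].

Lemma sqdist_gram (R : realType) (n m : nat) (N : 'M[R]_(n, m)) (u w : 'I_n) :
  sqdist (N *m N^T) u w = \sum_i (N u i - N w i) ^+ 2.
Proof.
rewrite /sqdist !mxE -big_split -!sumrB; apply: eq_bigr => i _ /=.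
by rewrite !mxE; ring.
Qed.

Lemma sqdistD (R : realType) (n : nat) (S T : 'M[R]_n) (u w : 'I_n) :
  sqdist (S + T) u w = sqdist S u w + sqdist T u w.
Proof. by rewrite /sqdist !mxE; ring. Qed.

Lemma sqdistZ (R : realType) (n : nat) (a : R) (S : 'M[R]_n) (u w : 'I_n) :
  sqdist (a *: S) u w = a * sqdist S u w.
Proof. by rewrite /sqdist !mxE; ring. Qed.

(** Factoring [B = N N^T] makes positivity polynomial: once the entries of [Z] and [N] are adjoined,
    the flex equations persist, and [N' k] times its transpose is positive semidefinite by its
    form. *)
Lemma flex_along (R : realType) (n d : nat) (e : rel 'I_n) (P Z : 'M[R]_(n, d))
    (B : 'M[R]_n) (x : nat -> 'M[R]_(n, d)) :
  generic_point P -> psdmx B ->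
  (forall u w, e u w ->
     sqdist B u w = \sum_i (Z u i - Z w i) * (P u i - P w i)) ->
  (forall u i, x k u i @[k --> \oo] --> P u i) ->
  exists (Z' : nat -> 'M[R]_(n, d)) (B' : nat -> 'M[R]_n),
    [/\ forall u i, Z' k u i @[k --> \oo] --> Z u i,
        forall u w, B' k u w @[k --> \oo] --> B u w,
        forall k, psdmx (B' k) &
        \forall k \near \oo, forall u w, e u w -> sqdist (B' k) u w =
          \sum_i (Z' k u i - Z' k w i) * (x k u i - x k w i)].
Proof.
move=> genP /psdmx_gram[N ->] flexZ xP.
have [D [ev [E [c [germE evc Ec]]]]] := genP x xP.
pose s := [seq Z t.1 t.2 | t <- enum {: 'I_n * 'I_d}] ++
  [seq N t.1 t.2 | t <- enum {: 'I_n * 'I_n}].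
have [D' [ev' [E' [j [germE' evj Ej sD']]]]] := germ_section_extend s germE.
have /choice[cZ cZE] : forall t : 'I_n * 'I_d, exists a, ev' a = Z t.1 t.2.
  move=> t; apply: sD'; rewrite mem_cat; apply/orP; left.
  by apply/mapP; exists t; rewrite ?mem_enum.
have /choice[cN cNE] : forall t : 'I_n * 'I_n, exists a, ev' a = N t.1 t.2.
  move=> t; apply: sD'; rewrite mem_cat; apply/orP; right.
  by apply/mapP; exists t; rewrite ?mem_enum.
have [E'ev' E'0] := germE'.
pose N' k := \matrix_(u, i) E' k (cN (u, i)).
have N'N u i : N' k u i @[k --> \oo] --> N u i.
  under eq_cvg do rewrite mxE.
  by rewrite -[N u i]/(N (u, i).1 (u, i).2) -cNE; exact: E'ev'.
exists (fun k => \matrix_(u, i) E' k (cZ (u, i))), (fun k => N' k *m (N' k)^T).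
split.
- move=> u i; under eq_cvg do rewrite mxE.
  by rewrite -[Z u i]/(Z (u, i).1 (u, i).2) -cZE; exact: E'ev'.
- move=> u w; rewrite mxE; under eq_cvg do rewrite mxE.
  apply: cvg_sumr => i _; rewrite mxE; under eq_cvg do rewrite [_^T _ _]mxE.
  exact: cvgM.
- by move=> k; exact: gram_psdmx.
pose r (u w : 'I_n) := \sum_i (cN (u, i) - cN (w, i)) ^+ 2
  - \sum_i (cZ (u, i) - cZ (w, i)) * (j (c u i) - j (c w i)).
have r0 u w : e u w -> ev' (r u w) = 0.
  move=> euw; rewrite /r rmorphB !rmorph_sum; apply/eqP; rewrite subr_eq0; apply/eqP.
  transitivity (sqdist (N *m N^T) u w).
    by rewrite sqdist_gram; apply: eq_bigr => i _; rewrite rmorphXn rmorphB /= !cNE.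
  rewrite flexZ //; apply: eq_bigr => i _.
  by rewrite rmorphM !rmorphB /= !cZE !evj !evc.
have : \forall k \near \oo, forall t : 'I_n * 'I_n, e t.1 t.2 -> E' k (r t.1 t.2) = 0.
  apply: filter_forall => t; have [et|et] := boolP (e t.1 t.2); last exact: nearW.
  by apply: filterS (E'0 _ (r0 _ _ et)).
apply: filterS => k Er u w euw; have /eqP := Er (u, w) euw.
rewrite /r rmorphB !rmorph_sum subr_eq0 => /eqP Ek.
rewrite sqdist_gram; transitivity (\sum_i E' k ((cN (u, i) - cN (w, i)) ^+ 2)).
  by apply: eq_bigr => i _; rewrite rmorphXn rmorphB /= !mxE.
rewrite Ek; apply: eq_bigr => i _.
by rewrite rmorphM !rmorphB /= !mxE !Ej !Ec.
Qed.

(** * The Frobenius inner product *)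

Definition dotmx (R : realType) (m n : nat) (A B : 'M[R]_(m, n)) : R :=
  \sum_u \sum_w A u w * B u w.

Lemma cvg_dotmx (R : realType) (m n : nat) (A B : nat -> 'M[R]_(m, n))
    (A' B' : 'M[R]_(m, n)) :
  (forall u w, A k u w @[k --> \oo] --> A' u w) ->
  (forall u w, B k u w @[k --> \oo] --> B' u w) ->
  dotmx (A k) (B k) @[k --> \oo] --> dotmx A' B'.
Proof.
by move=> AA' BB'; apply: cvg_sumr => u _; apply: cvg_sumr => w _; apply: cvgM.
Qed.

Lemma dotmxDl (R : realType) (m n : nat) (A B C : 'M[R]_(m, n)) :
  dotmx (A + B) C = dotmx A C + dotmx B C.
Proof.
rewrite /dotmx -big_split; apply: eq_bigr => u _; rewrite -big_split /=.
by apply: eq_bigr => w _; rewrite mxE mulrDl.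
Qed.

Lemma dotmxC (R : realType) (m n : nat) (A B : 'M[R]_(m, n)) :
  dotmx A B = dotmx B A.
Proof. by apply: eq_bigr => u _; apply: eq_bigr => w _; rewrite mulrC. Qed.

Lemma dotmxDr (R : realType) (m n : nat) (A B C : 'M[R]_(m, n)) :
  dotmx A (B + C) = dotmx A B + dotmx A C.
Proof. by rewrite dotmxC dotmxDl !(dotmxC A). Qed.

Lemma dotmxZl (R : realType) (m n : nat) (a : R) (A B : 'M[R]_(m, n)) :
  dotmx (a *: A) B = a * dotmx A B.
Proof.
rewrite /dotmx mulr_sumr; apply: eq_bigr => u _; rewrite mulr_sumr.
by apply: eq_bigr => w _; rewrite mxE mulrA.
Qed.

Lemma dotmxZr (R : realType) (m n : nat) (a : R) (A B : 'M[R]_(m, n)) :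
  dotmx A (a *: B) = a * dotmx A B.
Proof. by rewrite dotmxC dotmxZl dotmxC. Qed.

Lemma dotmx_ge0 (R : realType) (m n : nat) (A : 'M[R]_(m, n)) : 0 <= dotmx A A.
Proof.
by apply: sumr_ge0 => u _; apply: sumr_ge0 => w _; rewrite -expr2 sqr_ge0.
Qed.

Lemma dotmx_eq0 (R : realType) (m n : nat) (A : 'M[R]_(m, n)) :
  dotmx A A = 0 -> A = 0.
Proof.
move=> A0; apply/matrixP => u w; rewrite [RHS]mxE; apply/eqP; rewrite -sqrf_eq0.
have nn (v : 'I_m) : 0 <= \sum_j A v j * A v j.
  by apply: sumr_ge0 => j _; rewrite -expr2 sqr_ge0.
have /eqP := A0; rewrite psumr_eq0 => [/allP/(_ u)|i _]; last exact: nn.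
rewrite mem_index_enum => /(_ isT) /=.
rewrite psumr_eq0 => [/allP/(_ w)|j _]; last by rewrite -expr2 sqr_ge0.
by rewrite mem_index_enum -expr2 => /(_ isT).
Qed.

Lemma dotmx_gram (R : realType) (n m : nat) (B : 'M[R]_n) (N : 'M[R]_(n, m)) :
  dotmx B (N *m N^T) = \sum_i \sum_u N u i * (B *m N) u i.
Proof.
rewrite exchange_big; apply: eq_bigr => u _ /=.
under eq_bigr do rewrite mxE mulr_sumr.
rewrite exchange_big; apply: eq_bigr => i _ /=; rewrite mxE mulr_sumr.
by apply: eq_bigr => w _; rewrite mxE; ring.
Qed.

(** The pairing is the sum of the quadratic form of [B] over the columns of [N]. *)
Lemma dotmx_gram_ge0 (R : realType) (n m : nat) (B : 'M[R]_n) (N : 'M[R]_(n, m)) :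
  psdmx B -> 0 <= dotmx B (N *m N^T).
Proof.
move=> [_ B0]; rewrite dotmx_gram; apply: sumr_ge0 => i _.
apply: le_trans (B0 (row i N^T)) _; rewrite quadE le_eqVlt; apply/orP; left; apply/eqP.
apply: eq_bigr => u _; rewrite [in RHS]mxE mulr_sumr; apply: eq_bigr => w _.
by rewrite !mxE mulrA.
Qed.

(** Rows and columns of [B] sum to zero, so the diagonal terms of [sqdist] cancel. Hence [<B, S>]
    depends only on the distances, which rigidity controls. *)
Lemma dotmx_sqdist (R : realType) (n : nat) (B S : 'M[R]_n) :
  B^T = B -> B *m const_mx 1 = 0 :> 'cV_n ->
  \sum_u \sum_w B u w * sqdist S u w = - 2 * dotmx B S.
Proof.
move=> symB B1.
have rowB u : \sum_w B u w = 0.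
  have /colP/(_ u) := B1; rewrite mxE [RHS]mxE => h; rewrite -[RHS]h.
  by apply: eq_bigr => w _; rewrite mxE mulr1.
have Bsym u w : B w u = B u w by rewrite -[in LHS]symB mxE.
have Suu : \sum_u \sum_w B u w * S u u = 0.
  by rewrite big1 // => u _; rewrite -mulr_suml rowB mul0r.
have Sww : \sum_u \sum_w B u w * S w w = 0.
  rewrite exchange_big big1 // => w _ /=; rewrite -mulr_suml.
  by under eq_bigr do rewrite Bsym; rewrite rowB mul0r.
have Swu : \sum_u \sum_w B u w * S w u = dotmx B S.
  by rewrite exchange_big; apply: eq_bigr => w _; apply: eq_bigr => u _; rewrite Bsym.
transitivity (\sum_u \sum_w B u w * S u u + \sum_u \sum_w B u w * S w w
    - dotmx B S - \sum_u \sum_w B u w * S w u); last by rewrite Suu Sww Swu; ring.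
rewrite -big_split -!sumrB; apply: eq_bigr => u _ /=.
rewrite -big_split -!sumrB; apply: eq_bigr => w _ /=.
by rewrite /sqdist; ring.
Qed.

(** * The penalised problem *)

(** For [Y] positive semidefinite, [x *m x^T + Y] is the Gram matrix of the points of [x] lifted
    into further dimensions, [Y] being that of the added coordinates. *)
Definition edge_gap (R : realType) (n d : nat) (e : rel 'I_n)
    (P x : 'M[R]_(n, d)) (Y : 'M[R]_n) (u w : 'I_n) : R :=
  if e u w then sqdist (x *m x^T + Y) u w - sqdist (P *m P^T) u w else 0.

Definition edge_defect (R : realType) (n d : nat) (e : rel 'I_n)
    (P x : 'M[R]_(n, d)) (Y : 'M[R]_n) : R :=
  \sum_u \sum_w edge_gap e P x Y u w ^+ 2.

Definition gain (R : realType) (n d : nat) (P : 'M[R]_(n, d)) (B : 'M[R]_n)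
    (x : 'M[R]_(n, d)) (Y : 'M[R]_n) : R :=
  - dotmx B Y + dotmx (x - P) (x - P) + dotmx Y Y.

(** The box supplies compactness; [(P, 0)] is strictly inside the entry bounds, hence so are points
    close to it. *)
Definition in_box (R : realType) (n d : nat) (P x : 'M[R]_(n, d)) (Y : 'M[R]_n) :
    Prop :=
  [/\ forall u i, `|x u i - P u i| <= 1, forall u w, `|Y u w| <= 1 & psdmx Y].

Lemma cvg_edge_defect (R : realType) (n d : nat) (e : rel 'I_n)
    (P : 'M[R]_(n, d)) (x : nat -> 'M[R]_(n, d)) (Y : nat -> 'M[R]_n)
    (x' : 'M[R]_(n, d)) (Y' : 'M[R]_n) :
  (forall u i, x k u i @[k --> \oo] --> x' u i) ->
  (forall u w, Y k u w @[k --> \oo] --> Y' u w) ->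
  edge_defect e P (x k) (Y k) @[k --> \oo] --> edge_defect e P x' Y'.
Proof.
move=> xx' YY'; apply: cvg_sumr => u _; apply: cvg_sumr => w _; apply: cvg_exprn.
rewrite /edge_gap; case: ifP => _; last exact: cvg_cst.
apply: cvgB; last exact: cvg_cst.
apply: cvg_sqdist => a b; rewrite mxE; under eq_cvg do rewrite mxE.
apply: cvgD => //; rewrite mxE; under eq_cvg do rewrite mxE.
apply: cvg_sumr => i _; rewrite mxE; under eq_cvg do rewrite [_^T _ _]mxE.
exact: cvgM.
Qed.

Lemma cvg_gain (R : realType) (n d : nat) (P : 'M[R]_(n, d)) (B : 'M[R]_n)
    (x : nat -> 'M[R]_(n, d)) (Y : nat -> 'M[R]_n)
    (x' : 'M[R]_(n, d)) (Y' : 'M[R]_n) :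
  (forall u i, x k u i @[k --> \oo] --> x' u i) ->
  (forall u w, Y k u w @[k --> \oo] --> Y' u w) ->
  gain P B (x k) (Y k) @[k --> \oo] --> gain P B x' Y'.
Proof.
move=> xx' YY'.
have xP u i : (x k - P) u i @[k --> \oo] --> (x' - P) u i.
  rewrite !mxE; under eq_cvg do rewrite !mxE.
  by apply: cvgD; [exact: xx'|exact: cvg_cst].
apply: cvgD; last exact: cvg_dotmx.
apply: cvgD; last exact: cvg_dotmx.
by apply: cvgN; apply: cvg_dotmx => // u w; exact: cvg_cst.
Qed.

(** Zero defect and rigidity give [x *m x^T + Y] all the distances of [P], so [B] pairs with it to
    0. Since [<B, x *m x^T> >= 0], the term [- <B, Y>] is nonnegative and the gain is at least
    [|x - P|^2 + |Y|^2]. *)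
Lemma gain_critical (R : realType) (n d : nat) (e : rel 'I_n)
    (P : 'M[R]_(n, d)) (B : 'M[R]_n) (x : 'M[R]_(n, d)) (Y : 'M[R]_n) :
  (forall S : 'M[R]_n, psdmx S ->
     (forall u w, e u w -> sqdist S u w = sqdist (P *m P^T) u w) ->
     forall u w, sqdist S u w = sqdist (P *m P^T) u w) ->
  psdmx B -> B *m P = 0 -> B *m const_mx 1 = 0 :> 'cV_n ->
  psdmx Y -> edge_defect e P x Y <= 0 -> gain P B x Y <= 0 -> x = P /\ Y = 0.
Proof.
move=> rigP psdB BP B1 psdY def0 gain0.
have gap2 u w : edge_gap e P x Y u w ^+ 2 <= 0.
  apply: le_trans def0; rewrite /edge_defect (bigD1 u) //= (bigD1 w) //= -addrA lerDl.
  rewrite addr_ge0 // ?sumr_ge0 // => [v _|v _]; first exact: sqr_ge0.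
  by apply: sumr_ge0 => v' _; exact: sqr_ge0.
have distS u w : sqdist (x *m x^T + Y) u w = sqdist (P *m P^T) u w.
  apply: rigP => [|u' w' euw']; first by apply: psdmxD => //; exact: gram_psdmx.
  have := gap2 u' w'; rewrite /edge_gap euw' => g0; apply/eqP.
  by rewrite -subr_eq0 -sqrf_eq0 eq_le g0 sqr_ge0.
have dotS : dotmx B (x *m x^T + Y) = 0.
  have B0 : dotmx B (P *m P^T) = 0.
    rewrite dotmx_gram BP big1 // => i _; rewrite big1 // => u _.
    by rewrite mxE mulr0.
  have := dotmx_sqdist (x *m x^T + Y) psdB.1 B1.
  have := dotmx_sqdist (P *m P^T) psdB.1 B1.
  under eq_bigr do under eq_bigr do rewrite -distS.
  by move=> ->; rewrite B0; lra.
have Bx := dotmx_gram_ge0 x psdB.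
have nnx := dotmx_ge0 (x - P); have nnY := dotmx_ge0 Y.
move: gain0 dotS; rewrite (dotmxDr B) /gain => gain0 dotS.
split; last by apply: dotmx_eq0; lra.
by apply/eqP; rewrite -subr_eq0; apply/eqP/dotmx_eq0; lra.
Qed.

(** The competitor [(P, 0)] has value 0, so at a minimiser the gain is at most 0 and the defect at
    most [- gain / a k]; a limit point thus falls under [gain_critical]. The weights [a k] are left
    unspecified because a subsequence is extracted. *)
Lemma penalty_minimizers (R : realType) (n d : nat) (e : rel 'I_n)
    (P : 'M[R]_(n, d)) (B : 'M[R]_n) :
  (forall S : 'M[R]_n, psdmx S ->
     (forall u w, e u w -> sqdist S u w = sqdist (P *m P^T) u w) ->
     forall u w, sqdist S u w = sqdist (P *m P^T) u w) ->
  psdmx B -> B *m P = 0 -> B *m const_mx 1 = 0 :> 'cV_n ->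
  exists (x : nat -> 'M[R]_(n, d)) (Y : nat -> 'M[R]_n) (a : nat -> R),
    [/\ forall u i, x k u i @[k --> \oo] --> P u i,
        forall u w, Y k u w @[k --> \oo] --> 0,
        forall k, psdmx (Y k) &
        forall k x' Y', in_box P x' Y' ->
          a k * edge_defect e P (x k) (Y k) + gain P B (x k) (Y k) <=
          a k * edge_defect e P x' Y' + gain P B x' Y'].
Proof.
move=> rigP psdB BP B1.
(* The pair [(x, Y)] is flattened into one function on [T] to apply [bounded_closed_minimum]. *)
pose T : finType := ('I_n * 'I_d + 'I_n * 'I_n)%type.
pose X (z : T -> R) := \matrix_(u, i) z (inl (u, i)).
pose Y (z : T -> R) := \matrix_(u, w) z (inr (u, w)).
pose vec (x : 'M[R]_(n, d)) (y : 'M[R]_n) (t : T) :=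
  match t with inl t => x t.1 t.2 | inr t => y t.1 t.2 end.
have Xvec x y : X (vec x y) = x by apply/matrixP => i j; rewrite mxE.
have Yvec x y : Y (vec x y) = y by apply/matrixP => i j; rewrite mxE.
have Xcvg (u : nat -> T -> R) l : (forall t, u k t @[k --> \oo] --> l t) ->
    forall i j, X (u k) i j @[k --> \oo] --> X l i j.
  by move=> ul i j; rewrite mxE; under eq_cvg do rewrite mxE; exact: ul.
have Ycvg (u : nat -> T -> R) l : (forall t, u k t @[k --> \oo] --> l t) ->
    forall i j, Y (u k) i j @[k --> \oo] --> Y l i j.
  by move=> ul i j; rewrite mxE; under eq_cvg do rewrite mxE; exact: ul.
pose K z := in_box P (X z) (Y z).
pose M := \sum_u \sum_i `|P u i| + 1.
have KM z : K z -> forall t, `|z t| <= M.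
  move=> [xP Y1 _] [[u i]|[u w]]; last first.
    have := Y1 u w; rewrite mxE => /le_trans; apply; rewrite lerDr.
    by apply: sumr_ge0 => v _; apply: sumr_ge0.
  have Pui : `|P u i| <= \sum_u \sum_i `|P u i|.
    rewrite (bigD1 u) //= (bigD1 i) //= -addrA lerDl addr_ge0 ?sumr_ge0 //.
    by move=> v _; apply: sumr_ge0.
  have := xP u i; rewrite mxE => h.
  rewrite -[z _](subrK (P u i)); apply: le_trans (ler_normD _ _) _.
  by rewrite addrC lerD.
have Kclosed (u : nat -> T -> R) l : (forall k, K (u k)) ->
    (forall t, u k t @[k --> \oo] --> l t) -> K l.
  move=> Ku ul; split=> [v i|v w|].
  - have : `|X (u k) v i - P v i| @[k --> \oo] --> `|X l v i - P v i|.
      by apply: cvg_norm; apply: cvgB; [exact: Xcvg|exact: cvg_cst].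
    move=> cv; apply: cvg_le_lim cv _.
    by apply: nearW => k; have [] := Ku k.
  - have : `|Y (u k) v w| @[k --> \oo] --> `|Y l v w|.
      by apply: cvg_norm; exact: Ycvg.
    move=> cv; apply: cvg_le_lim cv _.
    by apply: nearW => k; have [] := Ku k.
  - by apply: psdmx_closed (Ycvg _ _ ul) => k; have [] := Ku k.
have K0 : K (vec P 0).
  rewrite /K Xvec Yvec; split=> [u i|u w|]; rewrite ?subrr ?mxE ?normr0 //.
  by split=> [|y]; rewrite ?trmx0 // mulmx0 mul0mx mxE.
have /choice[z zP] : forall k : nat, exists z, K z /\ forall w, K w ->
    k.+1%:R * edge_defect e P (X z) (Y z) + gain P B (X z) (Y z) <=
    k.+1%:R * edge_defect e P (X w) (Y w) + gain P B (X w) (Y w).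
  move=> k; have [|u l ul|z Kz zmin] := @bounded_closed_minimum R T K
    (fun z => k.+1%:R * edge_defect e P (X z) (Y z) + gain P B (X z) (Y z)) M _ KM Kclosed.
  - by exists (vec P 0).
  - apply: cvgD; last by apply: cvg_gain; [exact: Xcvg|exact: Ycvg].
    by apply: cvgM; [exact: cvg_cst|apply: cvg_edge_defect; [exact: Xcvg|exact: Ycvg]].
  - by exists z.
have f0 k : k.+1%:R * edge_defect e P (X (z k)) (Y (z k)) + gain P B (X (z k)) (Y (z k)) <= 0.
  have [_ /(_ _ K0)] := zP k; rewrite Xvec Yvec => /le_trans; apply.
  rewrite le_eqVlt; apply/orP; left; apply/eqP.
  have -> : edge_defect e P P 0 = 0.
    rewrite /edge_defect big1 // => u _; rewrite big1 // => w _.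
    by rewrite /edge_gap addr0 subrr if_same expr0n.
  have dot0 m' n' (A : 'M[R]_(m', n')) : dotmx A 0 = 0.
    by rewrite -(scale0r A) dotmxZr mul0r.
  by rewrite /gain subrr mulr0 !dot0; ring.
have [f finc [l zl]] := @bolzano_weierstrass_fin R T z M (fun k => KM _ (zP k).1).
have Kl : K l by apply: Kclosed zl => k; have [] := zP (f k).
have defl := cvg_edge_defect (e := e) (P := P) (Xcvg _ _ zl) (Ycvg _ _ zl).
have gainl := cvg_gain (P := P) (B := B) (Xcvg _ _ zl) (Ycvg _ _ zl).
have defect_ge0 x y : 0 <= edge_defect e P x y.
  by apply: sumr_ge0 => u _; apply: sumr_ge0 => w _; exact: sqr_ge0.
have gain0 : gain P B (X l) (Y l) <= 0.
  apply: cvg_le_lim gainl _; apply: nearW => k.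
  apply: le_trans (f0 (f k)); rewrite lerDr mulr_ge0 //.
have def0 : edge_defect e P (X l) (Y l) <= 0.
  have lim0 : - gain P B (X (z (f k))) (Y (z (f k))) * harmonic (f k) @[k --> \oo] --> (0 : R).
    rewrite -[X in _ --> X](mulr0 (- gain P B (X l) (Y l))); apply: cvgM; first exact: cvgN.
    by apply: (@cvg_subseq _ _ (fun k => harmonic k : R)) finc _; exact: cvg_harmonic.
  apply: ler_cvg_to defl lim0 _; apply: nearW => k.
  by rewrite ler_pdivlMr // mulrC -subr_le0 opprK; exact: f0.
have [psdl] := Kl; move=> _ psdYl.
have [Xl Yl] := gain_critical rigP psdB BP B1 psdYl def0 gain0.
exists (fun k => X (z (f k))), (fun k => Y (z (f k))), (fun k => (f k).+1%:R); split.
- by move=> u i; rewrite -Xl; exact: Xcvg.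
- by move=> u w; have := Ycvg _ _ zl u w; rewrite Yl mxE.
- by move=> k; have [[]] := zP (f k).
- move=> k x' Y' box'; have [_ /(_ (vec x' Y'))] := zP (f k).
  by rewrite /K Xvec Yvec; apply.
Qed.

(** Moving [x] by [- (s / 2) Z] changes a squared edge length to first order by
    [- s <Z u - Z w, x u - x w>], which the flex equation cancels against [s] times [sqdist B u w].
    Each edge gap therefore changes by a multiple of [s ^+ 2] alone. *)
Lemma edge_defect_along (R : realType) (n d : nat) (e : rel 'I_n)
    (P x Z : 'M[R]_(n, d)) (Y B : 'M[R]_n) :
  (forall u w, e u w ->
     sqdist B u w = \sum_i (Z u i - Z w i) * (x u i - x w i)) ->
  exists a b : R, forall s,
    edge_defect e P (x + (- (s / 2)) *: Z) (Y + s *: B) =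
    edge_defect e P x Y + s ^+ 2 * a + s ^+ 4 * b.
Proof.
move=> flexZ.
pose q u w := if e u w then \sum_i (Z u i - Z w i) ^+ 2 / 4 else 0.
exists (\sum_u \sum_w 2 * edge_gap e P x Y u w * q u w),
  (\sum_u \sum_w q u w ^+ 2) => s.
rewrite /edge_defect !mulr_sumr -!big_split; apply: eq_bigr => u _ /=.
rewrite !mulr_sumr -!big_split; apply: eq_bigr => w _ /=.
have -> : edge_gap e P (x + (- (s / 2)) *: Z) (Y + s *: B) u w =
    edge_gap e P x Y u w + s ^+ 2 * q u w; last by ring.
rewrite /edge_gap /q; case: ifP => euw; last by ring.
rewrite !sqdistD !sqdistZ flexZ // !sqdist_gram.
have -> : \sum_i ((x + (- (s / 2)) *: Z) u i - (x + (- (s / 2)) *: Z) w i) ^+ 2 =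
    \sum_i (x u i - x w i) ^+ 2 - s * (\sum_i (Z u i - Z w i) * (x u i - x w i))
    + s ^+ 2 * (\sum_i (Z u i - Z w i) ^+ 2 / 4); last by ring.
rewrite !mulr_sumr -sumrB -big_split; apply: eq_bigr => i _ /=.
by rewrite !mxE; field.
Qed.

Lemma gain_along (R : realType) (n d : nat) (P x Z : 'M[R]_(n, d))
    (B Y B' : 'M[R]_n) (s : R) :
  gain P B (x + (- (s / 2)) *: Z) (Y + s *: B') = gain P B x Y
  + s * (- dotmx B B' - dotmx (x - P) Z + 2 * dotmx Y B')
  + s ^+ 2 * (dotmx Z Z / 4 + dotmx B' B').
Proof.
rewrite /gain (addrAC x); move: (x - P) => D.
rewrite !(dotmxDl, dotmxDr, dotmxZl, dotmxZr) (dotmxC B' Y) (dotmxC Z D).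
by field.
Qed.

Lemma no_flex (R : realType) (n d : nat) (e : rel 'I_n) (P Z : 'M[R]_(n, d))
    (B : 'M[R]_n) :
  generic_point P ->
  (forall S : 'M[R]_n, psdmx S ->
     (forall u w, e u w -> sqdist S u w = sqdist (P *m P^T) u w) ->
     forall u w, sqdist S u w = sqdist (P *m P^T) u w) ->
  psdmx B -> B *m P = 0 -> B *m const_mx 1 = 0 :> 'cV_n ->
  (forall u w, e u w ->
     sqdist B u w = \sum_k (Z u k - Z w k) * (P u k - P w k)) ->
  B = 0.
Proof.
move=> genP rigP psdB BP B1 flexZ; apply: dotmx_eq0; apply/eqP.
rewrite eq_le dotmx_ge0 andbT leNgt; apply/negP => BB.
have [x [Y [a [xP Y0 psdY minxY]]]] := penalty_minimizers rigP psdB BP B1.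
have [Z' [B' [Z'Z B'B psdB' flexZ']]] := flex_along genP psdB flexZ xP.
(* The coefficient of [s] in [gain_along]. As [x k] tends to [P] and [Y k] to 0, only its first term
   survives. *)
have slope : - dotmx B (B' k) - dotmx (x k - P) (Z' k) + 2 * dotmx (Y k) (B' k)
    @[k --> \oo] --> - dotmx B B.
  have dot0 m' n' (A : 'M[R]_(m', n')) : dotmx 0 A = 0.
    by rewrite -(scale0r A) dotmxZl mul0r.
  rewrite -[X in _ --> X]addr0 -[X in _ --> _ + X](mulr0 2) -(dot0 _ _ B).
  rewrite -[X in _ --> X + _]subr0 -[X in _ --> _ - X + _](dot0 _ _ Z).
  apply: cvgD; last first.
    by apply: cvgM; [exact: cvg_cst|apply: cvg_dotmx => // u w; rewrite mxE; exact: Y0].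
  apply: cvgB; first by apply: cvgN; apply: cvg_dotmx => // u w; exact: cvg_cst.
  apply: cvg_dotmx => // u i; rewrite mxE -[X in _ --> X](subrr (P u i)).
  by under eq_cvg do rewrite !mxE; apply: cvgB; [exact: xP|exact: cvg_cst].
have ltBB : - dotmx B B < 0 by rewrite oppr_lt0.
have near_slope : \forall k \near \oo, - dotmx B (B' k) - dotmx (x k - P) (Z' k)
    + 2 * dotmx (Y k) (B' k) < 0 by exact: (cvgr_lt _ slope).
have near_x : \forall k \near \oo, forall t : 'I_n * 'I_d,
    `|x k t.1 t.2 - P t.1 t.2| < 1.
  apply: filter_forall => t; have /cvgrPdist_lt/(_ 1 ltr01) := xP t.1 t.2.
  by apply: filterS => k; rewrite distrC.
have near_Y : \forall k \near \oo, forall t : 'I_n * 'I_n, `|Y k t.1 t.2| < 1.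
  apply: filter_forall => t; have /cvgrPdist_lt/(_ 1 ltr01) := Y0 t.1 t.2.
  by apply: filterS => k; rewrite sub0r normrN.
(* One [k], hence one weight [a k], is fixed here; the step sizes [harmonic j] then tend to 0
   independently of it. *)
have [k [[slopek flexk] xk Yk]] : exists k, [/\ - dotmx B (B' k)
    - dotmx (x k - P) (Z' k) + 2 * dotmx (Y k) (B' k) < 0 /\ (forall u w, e u w ->
      sqdist (B' k) u w = \sum_i (Z' k u i - Z' k w i) * (x k u i - x k w i)),
    forall t : 'I_n * 'I_d, `|x k t.1 t.2 - P t.1 t.2| < 1 &
    forall t : 'I_n * 'I_n, `|Y k t.1 t.2| < 1].
  by near \oo => k; exists k; split; [split|..]; near: k.
have [a2 [a4 defk]] := edge_defect_along P (Y k) flexk.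
set c1 := - dotmx B (B' k) - _ + _ in slopek.
pose c2 := a k * a2 + (dotmx (Z' k) (Z' k) / 4 + dotmx (B' k) (B' k)).
have h0 : (harmonic j : R) @[j --> \oo] --> (0 : R) by exact: cvg_harmonic.
(* The entry bounds are strict at [(x k, Y k)], so short steps keep them, and adding a nonnegative
   multiple of [B' k] preserves positivity. *)
have in_boxk : \forall j \near \oo, in_box P (x k + (- (harmonic j / 2)) *: Z' k)
    (Y k + harmonic j *: B' k).
  have near_x' : \forall j \near \oo, forall t : 'I_n * 'I_d,
      `|x k t.1 t.2 - P t.1 t.2 - harmonic j / 2 * Z' k t.1 t.2| < 1.
    apply: filter_forall => t; apply: (cvgr_lt `|x k t.1 t.2 - P t.1 t.2|) (xk t).
    have : `|x k t.1 t.2 - P t.1 t.2 - harmonic j / 2 * Z' k t.1 t.2|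
        @[j --> \oo] --> `|x k t.1 t.2 - P t.1 t.2 - 0 / 2 * Z' k t.1 t.2|.
      apply: cvg_norm; apply: cvgB; first exact: cvg_cst.
      by apply: cvgM; [apply: cvgM => //; exact: cvg_cst|exact: cvg_cst].
    by rewrite !mul0r subr0.
  have near_Y' : \forall j \near \oo, forall t : 'I_n * 'I_n,
      `|Y k t.1 t.2 + harmonic j * B' k t.1 t.2| < 1.
    apply: filter_forall => t; apply: (cvgr_lt `|Y k t.1 t.2|) (Yk t).
    have : `|Y k t.1 t.2 + harmonic j * B' k t.1 t.2|
        @[j --> \oo] --> `|Y k t.1 t.2 + 0 * B' k t.1 t.2|.
      apply: cvg_norm; apply: cvgD; first exact: cvg_cst.
      by apply: cvgM => //; exact: cvg_cst.
    by rewrite mul0r addr0.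
  apply: filterS2 near_x' near_Y' => j hx hY; split=> [u i|u w|].
  - have -> : (x k + (- (harmonic j / 2)) *: Z' k) u i - P u i =
        x k u i - P u i - harmonic j / 2 * Z' k u i by rewrite !mxE; ring.
    exact/ltW/(hx (u, i)).
  - rewrite [(Y k + _) u w]mxE [(_ *: B' k) u w]mxE.
    exact/ltW/(hY (u, w)).
  - by apply: psdmxD => //; apply: psdmxZ => //; exact: harmonic_ge0.
(* The increment of the penalised function divided by the step [harmonic j]; its limit [c1 < 0]
   contradicts minimality. *)
have near_neg : \forall j \near \oo,
    c1 + harmonic j * c2 + harmonic j ^+ 3 * (a k * a4) < 0.
  apply: (cvgr_lt c1) slopek.
  have : c1 + harmonic j * c2 + harmonic j ^+ 3 * (a k * a4)
      @[j --> \oo] --> c1 + 0 * c2 + 0 ^+ 3 * (a k * a4).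
    apply: cvgD; last by apply: cvgM; [exact: cvg_exprn|exact: cvg_cst].
    by apply: cvgD; [exact: cvg_cst|apply: cvgM => //; exact: cvg_cst].
  by rewrite expr0n !mul0r !addr0.
have [j [boxj negj]] : exists j, in_box P (x k + (- (harmonic j / 2)) *: Z' k)
    (Y k + harmonic j *: B' k) /\
    c1 + harmonic j * c2 + harmonic j ^+ 3 * (a k * a4) < 0.
  by near \oo => j; exists j; split; near: j.
have := minxY k _ _ boxj; rewrite defk gain_along -/c1 -subr_ge0.
set h : R := harmonic j in negj *.
have -> : a k * (edge_defect e P (x k) (Y k) + h ^+ 2 * a2 + h ^+ 4 * a4) +
    (gain P B (x k) (Y k) + h * c1 +
     h ^+ 2 * (dotmx (Z' k) (Z' k) / 4 + dotmx (B' k) (B' k))) -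
    (a k * edge_defect e P (x k) (Y k) + gain P B (x k) (Y k)) =
    h * (c1 + h * c2 + h ^+ 3 * (a k * a4)) by rewrite /c2; ring.
by rewrite pmulr_rge0 ?harmonic_gt0 // leNgt negj.
Unshelve. all: end_near. Qed.

(** * Algebraically independent coordinates *)

(** Convertible to [generic] for [a] the coordinate vector of a configuration; the number [m] of
    variables is left free. *)
Definition alg_independent (R : realType) (m : nat) (a : 'I_m -> R) : Prop :=
  forall Q : mpoly m rat, Q != 0 -> meval a (map_mpoly (@ratr R) Q) != 0.

(** Evaluation is continuous, and independence leaves only 0 in the kernel of evaluation at [a], so
    only the trivial relation has to persist. *)
Lemma alg_independent_germ (R : realType) (m : nat) (a : 'I_m -> R)
    (y : nat -> 'I_m -> R) :
  alg_independent a -> (forall i, y k i @[k --> \oo] --> a i) ->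
  germ_section (meval a \o map_mpoly (@ratr R))
    (fun k => meval (y k) \o map_mpoly (@ratr R)).
Proof.
move=> indep ya; split=> Q /=.
  rewrite mevalE; under eq_cvg do rewrite mevalE.
  apply: cvg_sumr => mon _; apply: cvgM; first exact: cvg_cst.
  by apply: cvg_prodr => i _; exact: cvg_exprn.
have [->|Q0] := eqVneq Q 0; last by move=> evQ; have := indep Q Q0; rewrite evQ eqxx.
by move=> _; apply: nearW => k; rewrite !raddf0.
Qed.

Definition entry_index (n d m : nat) (idx : 'I_n -> 'I_d -> 'I_m) : Prop :=
  forall u i u' i', idx u i = idx u' i' -> u = u' /\ i = i'.

(** Extends [x] to a point with [m] coordinates, those of [a] serving at the indices that [idx]
    misses. *)
Definition fill (R : Type) (n d m : nat) (idx : 'I_n -> 'I_d -> 'I_m)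
    (x : 'I_n -> 'I_d -> R) (a : 'I_m -> R) (r : 'I_m) : R :=
  if [pick t : 'I_n * 'I_d | idx t.1 t.2 == r] is Some t then x t.1 t.2 else a r.

Lemma fillE (R : Type) (n d m : nat) (idx : 'I_n -> 'I_d -> 'I_m)
    (x : 'I_n -> 'I_d -> R) (a : 'I_m -> R) (u : 'I_n) (i : 'I_d) :
  entry_index idx -> fill idx x a (idx u i) = x u i.
Proof.
move=> idx_inj; rewrite /fill; case: pickP => [[u' i'] /= /eqP/idx_inj[-> ->] //|].
by move=> /(_ (u, i)); rewrite eqxx.
Qed.

Lemma alg_independent_generic_point (R : realType) (n d m : nat)
    (P : 'M[R]_(n, d)) (a : 'I_m -> R) (idx : 'I_n -> 'I_d -> 'I_m) :
  alg_independent a -> entry_index idx -> (forall u i, P u i = a (idx u i)) ->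
  generic_point P.
Proof.
move=> indep idx_inj Pa x xP.
exists (mpoly m rat), (meval a \o map_mpoly (@ratr R)),
  (fun k => meval (fill idx (x k) a) \o map_mpoly (@ratr R)),
  (fun u i => mpolyX rat (mnm1 (idx u i))); split.
- apply: alg_independent_germ => // r; rewrite /fill.
  case: pickP => [[u i] /= /eqP <-|_]; last exact: cvg_cst.
  by rewrite -Pa; exact: xP.
- by move=> u i; rewrite /= map_mpolyX mevalXU Pa.
- by move=> k u i; rewrite /= map_mpolyX mevalXU fillE.
Qed.

(** The minor on the first [d + 1] rows is a rational polynomial in the coordinates. It equals 1 at
    the simplex formed by the basis vectors and the origin, so it is not the zero polynomial and
    cannot vanish at [P]. *)
Lemma alg_independent_affine_rank (R : realType) (n d m : nat)
    (P : 'M[R]_(n, d)) (a : 'I_m -> R) (idx : 'I_n -> 'I_d -> 'I_m) :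
  (d + 1 <= n)%N ->
  alg_independent a -> entry_index idx -> (forall u i, P u i = a (idx u i)) ->
  \rank (row_mx P (const_mx 1 : 'M_(n, 1))) = (d + 1)%N.
Proof.
move=> dn indep idx_inj Pa.
pose f := widen_ord dn.
pose QX : 'M[mpoly m rat]_(d + 1) := \matrix_(i, j)
  match fintype.split j with inl j' => mpolyX rat (mnm1 (idx (f i) j')) | inr _ => 1 end.
have mapQX v : map_mx (meval v \o map_mpoly (@ratr R)) QX =
    \matrix_(i, j) match fintype.split j with inl j' => v (idx (f i) j') | inr _ => 1 end.
  apply/matrixP => i j; rewrite !mxE; case: fintype.split => j' /=; last by rewrite !rmorph1.
  by rewrite map_mpolyX mevalXU.
have detQ : \det (rowsub f (row_mx P (const_mx 1 : 'M_(n, 1)))) != 0.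
  have -> : rowsub f (row_mx P (const_mx 1 : 'M_(n, 1))) =
      map_mx (meval a \o map_mpoly (@ratr R)) QX.
    rewrite mapQX; apply/matrixP => i j; rewrite !mxE.
    by case: fintype.split => j'; rewrite ?mxE ?Pa.
  rewrite det_map_mx /=; apply: indep; apply/eqP => QX0.
  (* Point [i < d] is a basis vector and point [d] the origin; with the column of ones the matrix is
     upper unitriangular. *)
  pose v := fill idx (fun u i => ((u : nat) == i)%:R : R) (fun=> 0).
  have : \det (map_mx (meval v \o map_mpoly (@ratr R)) QX) = 0.
    by rewrite det_map_mx QX0 raddf0.
  rewrite mapQX -det_tr det_trig.
    rewrite big1 => [/eqP|i _]; first by rewrite oner_eq0.
    by rewrite !mxE; case: splitP => // j ij; rewrite /v fillE //= ij eqxx.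
  apply/is_trig_mxP => i j ij; rewrite !mxE; case: splitP => [k ik|k ik].
    by rewrite /v fillE //= -ik gtn_eqF.
  by exfalso; move: ij (ltn_ord j) ik; rewrite ord1 /=; lia.
apply/eqP; rewrite eqn_leq rank_leq_col.
have : (d + 1)%N = \rank (rowsub f (row_mx P (const_mx 1 : 'M_(n, 1)))).
  by apply/esym/mxrank_unit; rewrite unitmxE unitfE.
by move=> {1}->; apply: mxrankS; apply/row_subP => i; rewrite row_rowsub row_sub.
Qed.

(** [kermx A] consists of the vectors orthogonal to the columns of [A]. The kernel of [Om] contains
    the span of those columns, of dimension [d + 1], and meets [kermx A] in 0, which fixes the rank;
    on [kermx A] the form is positive. *)
Lemma stress_rank_psd (R : realType) (n d : nat) (P : 'M[R]_(n, d))
    (Om : 'M[R]_n) :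
  Om^T = Om -> Om *m P = 0 -> Om *m const_mx 1 = 0 :> 'cV_n ->
  (forall y : 'rV_n, y != 0 -> y *m P = 0 -> y *m const_mx 1 = 0 :> 'rV_1 ->
     0 < (y *m Om *m y^T) 0 0) ->
  \rank (row_mx P (const_mx 1 : 'M_(n, 1))) = (d + 1)%N ->
  \rank Om = (n - (d + 1))%N /\ psdmx Om.
Proof.
set A := row_mx P _ => symOm OmP Om1 posU rankA.
have OmA : Om *m A = 0 by rewrite mul_mx_row OmP Om1 row_mx0.
have AOm : A^T *m Om = 0 by rewrite -symOm -trmx_mul OmA trmx0.
have pos (y : 'rV_n) : y != 0 -> y *m A = 0 -> 0 < (y *m Om *m y^T) 0 0.
  move=> y0; rewrite mul_mx_row => yA.
  have /eq_row_mx[yP y1] : row_mx (y *m P) (y *m (const_mx 1 : 'cV_n)) = row_mx 0 0.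
    by rewrite yA row_mx0.
  exact: posU.
have rankU : \rank (kermx A) = (n - (d + 1))%N by rewrite mxrank_ker rankA.
have dn : (d + 1 <= n)%N by rewrite -rankA rank_leq_row.
have capOm : (kermx Om :&: kermx A)%MS = 0.
  apply/eqP/rowV0P => y; rewrite sub_capmx => /andP[/sub_kermxP yOm /sub_kermxP yA].
  apply/eqP; apply/negPn/negP => y0; have := pos y y0 yA.
  by rewrite yOm mul0mx mxE ltxx.
have capA : (A^T :&: kermx A)%MS = 0.
  apply/eqP/rowV0P => y; rewrite sub_capmx => /andP[/submxP[D yD] /sub_kermxP yA].
  apply: dotmx_eq0; rewrite /dotmx big_ord1.
  have : (y *m y^T) 0 0 = 0.
    by rewrite {2}yD trmx_mul trmxK mulmxA yA mul0mx mxE.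
  by rewrite mxE => yy; rewrite -[RHS]yy; apply: eq_bigr => i _; rewrite [y^T _ _]mxE.
have rkOm : \rank Om = (n - (d + 1))%N.
  have := mxrank_sum_cap (kermx Om) (kermx A).
  rewrite capOm mxrank0 addn0 rankU mxrank_ker.
  have := rank_leq_col (kermx Om + kermx A)%MS.
  have /sub_kermxP/mxrankS := AOm.
  rewrite mxrank_tr rankA mxrank_ker; have := rank_leq_row Om.
  move: (\rank Om) (\rank (_ + _)%MS) dn => r s; clear; lia.
split=> //; split=> // x.
(* Orthogonal splitting [x = q + w] with [q] in the span of the columns of [A]; the form at [x]
   depends on [w] alone. *)
have full : row_full (A^T + kermx A)%MS.
  have := mxrank_sum_cap A^T (kermx A).
  by rewrite capA mxrank0 addn0 rankU mxrank_tr rankA subnKC // => rk; apply/eqP.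
have /sub_addsmxP[D xD] := submx_full x full.
set q := D.1 *m _ in xD; set w := D.2 *m _ in xD.
have qOm : q *m Om = 0 by rewrite -mulmxA AOm mulmx0.
have Omq : Om *m q^T = 0 by rewrite -[Om]symOm -trmx_mul qOm trmx0.
have -> : x *m Om *m x^T = w *m Om *m w^T.
  by rewrite xD mulmxDl qOm add0r raddfD /= mulmxDr -mulmxA Omq mulmx0 add0r.
have [->|w0] := eqVneq w 0; first by rewrite !mul0mx mxE.
by apply/ltW/pos => //; rewrite -mulmxA mulmx_ker mulmx0.
Qed.

(** * Frameworks *)

Lemma enorm_sqr (R : realType) (n : nat) (x : 'rV[R]_n) :
  enorm x ^+ 2 = \sum_i x 0 i ^+ 2.
Proof. by rewrite sqr_sqrtr //; apply: sumr_ge0 => i _; exact: sqr_ge0. Qed.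

Lemma eq_enorm (R : realType) (m n : nat) (x : 'rV[R]_m) (y : 'rV[R]_n) :
  enorm x = enorm y <-> \sum_i x 0 i ^+ 2 = \sum_i y 0 i ^+ 2.
Proof. by split=> [xy|xy]; [rewrite -!enorm_sqr xy|rewrite /enorm xy]. Qed.

Theorem theorem1 (R : realType) (V : finType) (G : graph V) (d : nat)
    (hv : (d + 2 <= #|V|)%N) (p : config R V) (hp : in_Cd d p)
    (hgen : generic d p) (hrig : universally_rigid p G) :
  exists Omega : V -> V -> R,
    [/\ equilibrium_stress p G Omega, psd Omega
      & rank Omega = (#|V| - d - 1)%N].
Proof.
have dV : (d <= #|V|)%N by apply: leq_trans hv; rewrite leq_addr.
pose e : rel 'I_#|V| := fun i j => [set enum_val i; enum_val j]%SET \in edges G.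
pose P := \matrix_(i < #|V|, k < d) p (enum_val i) 0 (widen_ord dV k).
have in_index (i : 'I_#|V|) (k : 'I_d) :
    (enum_val i, widen_ord dV k) \in coord_index V d by rewrite inE /=.
pose idx i k := enum_rank_in (in_index i k) (enum_val i, widen_ord dV k).
have idxK i k : enum_val (idx i k) = (enum_val i, widen_ord dV k).
  by rewrite enum_rankK_in.
have idx_inj : entry_index idx.
  move=> u i u' i' eq_idx; have := idxK u i; rewrite eq_idx idxK => -[/enum_val_inj-> ii'].
  by split=> //; apply: val_inj.
have Pcoord i k : P i k = Defs.coord p (idx i k)
  by rewrite mxE /Defs.coord idxK.
have genP : generic_point P := alg_independent_generic_point hgen idx_inj Pcoord.
(* Coordinates from [d] on vanish by [hp], so the [d] columns of [P] carry all distances. *)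
have distP u w : \sum_i (p u - p w) 0 i ^+ 2 =
    sqdist (P *m P^T) (enum_rank u) (enum_rank w).
  rewrite sqdist_gram (bigID (fun i : 'I_#|V| => (i < d)%N)) /= [X in _ + X]big1.
    rewrite addr0 (big_ord_narrow dV); apply: eq_bigr => k _.
    by rewrite !mxE !enum_rankK.
  by move=> i; rewrite -leqNgt => di; rewrite !mxE !hp // subrr expr0n.
(* Configurations live in dimension [#|V|], so the rows of the square Gram factor [N] of [S] form
   one, and universal rigidity applies to it. *)
have rigP (S : 'M[R]_#|V|) : psdmx S ->
    (forall u w, e u w -> sqdist S u w = sqdist (P *m P^T) u w) ->
    forall u w, sqdist S u w = sqdist (P *m P^T) u w.
  move=> /psdmx_gram[N ->] edgeN u w.
  pose q : config R V := fun v => row (enum_rank v) N.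
  have distq a b : \sum_i (q a - q b) 0 i ^+ 2 =
      sqdist (N *m N^T) (enum_rank a) (enum_rank b).
    by rewrite sqdist_gram; apply: eq_bigr => i _; rewrite !mxE.
  have [|f rigf qf] := hrig q.
    move=> a b ab; apply/eq_enorm; rewrite distq distP; apply: edgeN.
    by rewrite /e !enum_rankK.
  have := distq (enum_val u) (enum_val w); rewrite !enum_valK => <-.
  have := distP (enum_val u) (enum_val w); rewrite !enum_valK => <-.
  by apply/eq_enorm; rewrite !qf.
have [[c OmP posU]|[B [Z [psdB B0 BP B1 flexZ]]]] := stress_or_flex e P; last first.
  by have := no_flex genP rigP psdB BP B1 flexZ => /eqP; rewrite (negPf B0).
set Om := edge_stress e c in OmP posU.
have rankP : \rank (row_mx P (const_mx 1 : 'cV_#|V|)) = (d + 1)%N.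
  apply: alg_independent_affine_rank hgen idx_inj Pcoord.
  by apply: leq_trans hv; rewrite leq_add2l.
have [rankOm psdOm] := stress_rank_psd (edge_stress_sym e c) OmP
  (edge_stress_mul1 e c) posU rankP.
have sumV (F : V -> 'I_#|V| -> R) : \sum_w F w (enum_rank w) =
    \sum_j F (enum_val j) j.
  by rewrite sum_enum_val; apply: eq_bigr => j _; rewrite enum_valK.
exists (fun u w => Om (enum_rank u) (enum_rank w)); split.
- split=> [u w|u w uw edge|u|u].
  + by rewrite -[in LHS](edge_stress_sym e c : Om^T = Om) mxE.
  + apply: edge_stress_supp.
    * by apply: contraNneq uw => /enum_rank_inj ->.
    * by rewrite /e !enum_rankK.
    * by rewrite /e !enum_rankK finset.setUC.
  + rewrite (sumV (fun _ j => Om (enum_rank u) j)).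
    have /colP/(_ (enum_rank u)) := edge_stress_mul1 e c.
    rewrite mxE [RHS]mxE => h; rewrite -[RHS]h.
    by apply: eq_bigr => j _; rewrite [const_mx _ _ _]mxE mulr1.
  + apply/rowP => i; rewrite summxE [RHS]mxE.
    (* The coordinates [i >= d] of [p] are zero; the others are columns of [P]. *)
    have [id|di] := ltnP i d; last by rewrite big1 // => w _; rewrite mxE hp ?mulr0.
    have /matrixP/(_ (enum_rank u) (Ordinal id)) := OmP.
    rewrite mxE [RHS]mxE => h; rewrite -[RHS]h.
    under eq_bigr do rewrite mxE.
    rewrite (sumV (fun w j => Om (enum_rank u) j * p w 0 i)).
    apply: eq_bigr => j _; rewrite [P _ _]mxE; congr (_ * p _ 0 _).
    exact: val_inj.
- move=> x; pose x' : 'rV_#|V| := \row_j x (enum_val j).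
  have := psdOm.2 x'; rewrite quadE.
  rewrite (sumV (fun u i => \sum_w x u * Om i (enum_rank w) * x w)).
  congr (0 <= _); apply: eq_bigr => i _.
  rewrite (sumV (fun w j => x (enum_val i) * Om i j * x w)).
  by apply: eq_bigr => j _; rewrite ![x' _ _]mxE.
- rewrite -subnDA -rankOm; congr (\rank _).
  by apply/matrixP => i j; rewrite [LHS]mxE !enum_valK.
Qed.
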